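(* Let $(\mathcal{X},\ \rho^{B_1B_2}_x,\ \mathcal{H}^{B_1}\otimes\mathcal{H}^{B_2})$ be a classical-quantum broadcast channel, let $\mathcal{W}$ be a finite set and $p=p_W(w)p_{X|W}(x|w)$ a distribution on $\mathcal{W}\times\mathcal{X}$. Then every rate pair $(R_1,R)\in\mathbb{R}_+^2$ with $$R_1\le I(X;B_1|W)_\theta,\qquad R\le I(W;B_2)_\theta,\qquad R_1+R\le I(X;B_1)_\theta$$ is achievable, in the sense that the rate triple $(R_1,R,0)$ (personal rate $R_1$ to Receiver 1, common rate $R$, personal rate $0$ to Receiver 2) is achievable for the broadcast channel. Here $\theta^{WXB_1B_2}=\sum_{w,x}p_W(w)p_{X|W}(x|w)|w\rangle\langle w|^W\otimes|x\rangle\langle x|^X\otimes\rho^{B_1B_2}_x$.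
   Context: A classical-quantum broadcast channel: finite input alphabet $\mathcal{X}$ and density operators $\rho^{B_1B_2}_x$ on finite-dimensional $\mathcal{H}^{B_1}\otimes\mathcal{H}^{B_2}$; Receiver $j$ holds $B_j$; $n$ uses give $\rho^{B_1^nB_2^n}_{x^n}=\bigotimes_i\rho^{B_1B_2}_{x_i}$. An $(n,R_1,R,R_2,\epsilon)$ code consists of a codebook $\{x^n(m_1,m,m_2)\}$ with $m_1\in\mathcal{M}_1,m\in\mathcal{M},m_2\in\mathcal{M}_2$, $|\mathcal{M}_1|=2^{nR_1},|\mathcal{M}|=2^{nR},|\mathcal{M}_2|=2^{nR_2}$, a POVM $\{\Lambda_{m_1,m}\}$ on $B_1^n$ and a POVM $\{\Gamma_{m,m_2}\}$ on $B_2^n$, with $\frac{1}{|\mathcal{M}_1||\mathcal{M}||\mathcal{M}_2|}\sum_{m_1,m,m_2}\mathrm{Tr}[(I-\Lambda_{m_1,m}\otimes\Gamma_{m,m_2})\rho^{B_1^nB_2^n}_{x^n(m_1,m,m_2)}]\le\epsilon$. A triple $(R_1,R,R_2)$ is achievable if an $(n,R_1-\delta,R-\delta,R_2-\delta,\epsilon)$ code exists for all $\epsilon,\delta>0$ and sufficiently large $n$. Mutual informations are quantum (base 2). *)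

(* Defs.v *)
From HB Require Import structures.
From mathcomp Require Import all_boot all_order all_algebra.
From mathcomp Require Import all_classical all_reals.
From mathcomp Require Import exp.
From mathcomp.real_closed Require Import complex.

Set Implicit Arguments.
Unset Strict Implicit.
Unset Printing Implicit Defensive.

Import Order.TTheory GRing.Theory Num.Theory.
Local Open Scope ring_scope.
Local Open Scope complex_scope.

Section Quantum.
Variable R : realType.
Local Notation C := (R[i])%type.

(* An operator on the Hilbert space C^T (T a finite index set of an
   orthonormal basis), given by its matrix entries <s|A|t>. *)
Definition op (T : finType) := T -> T -> C.

Definition idop (T : finType) : op T := fun s t => (s == t)%:R.

Definition trace (T : finType) (A : op T) : C := \sum_t A t t.

Definition trmul (T : finType) (A B : op T) : C := \sum_s \sum_t A s t * B t s.

(* positive semidefinite: <v|A|v> >= 0 for all vectors v (for complex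
   matrices this also forces A to be Hermitian) *)
Definition psd (T : finType) (A : op T) : Prop :=
  forall v : T -> C, 0 <= \sum_s \sum_t conjc (v s) * A s t * v t.

Definition density (T : finType) (A : op T) : Prop := psd A /\ trace A = 1.

Definition povm (I T : finType) (L : I -> op T) : Prop :=
  (forall i, psd (L i)) /\ (forall s t, \sum_i L i s t = idop s t).

Definition tens (A B : finType) (P : op A) (Q : op B) : op (A * B)%type :=
  fun s t => P s.1 t.1 * Q s.2 t.2.

(* Partial trace in coordinates: the system T is split as U (kept,
   coordinate map k) and V (traced out, coordinate map d). *)
Definition marg (T U V : finType) (k : T -> U) (d : T -> V) (A : op T) : op U :=
  fun u u' => \sum_t \sum_t' ((k t == u) && (k t' == u') && (d t == d t'))%:R * A t t'.

Definition opmx (T : finType) (A : op T) : 'M[C]_#|T| :=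
  \matrix_(i, j) A (enum_val i) (enum_val j).

Definition spectrum (T : finType) (A : op T) (s : seq R) : Prop :=
  char_poly (opmx A) = \prod_(a <- s) ('X - (a%:C)%:P).

Definition log2 (x : R) : R := ln x / ln 2.

Definition entropy (T : finType) (A : op T) : R :=
  - \sum_(a <- xget [::] (spectrum A)) a * log2 a.

Definition qMI (A B : finType) (rho : op (A * B)%type) : R :=
  entropy (marg fst snd rho) + entropy (marg snd fst rho) - entropy rho.

Definition qCMI (A B D : finType) (rho : op (A * B * D)%type) : R :=
  entropy (marg (fun t => (t.1.1, t.2)) (fun t => t.1.2) rho)
  + entropy (marg (fun t => (t.1.2, t.2)) (fun t => t.1.1) rho)
  - entropy rho
  - entropy (marg snd fst rho).


Definition msize (n : nat) (r : R) : nat := `|Num.ceil (2 `^ (n%:R * r))|%N.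

Definition nstate (X B1 B2 : finType) (rho : X -> op (B1 * B2)%type) (n : nat)
  (xn : 'I_n -> X) : op ({ffun 'I_n -> B1} * {ffun 'I_n -> B2})%type :=
  fun s t => \prod_(i < n) rho (xn i) (s.1 i, s.2 i) (t.1 i, t.2 i).

Definition code_exists (X B1 B2 : finType) (rho : X -> op (B1 * B2)%type)
  (n : nat) (R1 Rc R2 eps : R) : Prop :=
  exists (f : 'I_(msize n R1) -> 'I_(msize n Rc) -> 'I_(msize n R2) -> 'I_n -> X)
         (Lam : ('I_(msize n R1) * 'I_(msize n Rc))%type -> op {ffun 'I_n -> B1})
         (Gam : ('I_(msize n Rc) * 'I_(msize n R2))%type -> op {ffun 'I_n -> B2}),
    [/\ povm Lam, povm Gam &
      ((msize n R1 * msize n Rc * msize n R2)%N%:R)^-1 *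
        (\sum_(m1 < msize n R1) \sum_(m < msize n Rc) \sum_(m2 < msize n R2)
           trmul (fun s t => idop s t - tens (Lam (m1, m)) (Gam (m, m2)) s t)
                 (nstate rho (f m1 m m2)))
      <= eps%:C].

Definition achievable (X B1 B2 : finType) (rho : X -> op (B1 * B2)%type)
  (R1 Rc R2 : R) : Prop :=
  forall eps delta : R, 0 < eps -> 0 < delta ->
    exists N : nat, forall n : nat, (N <= n)%N ->
      code_exists rho n (R1 - delta) (Rc - delta) (R2 - delta) eps.

Definition theta (W X B1 B2 : finType) (pW : W -> R) (pXW : W -> X -> R)
  (rho : X -> op (B1 * B2)%type) : op (W * X * B1 * B2)%type :=
  fun s t => \sum_(w : W) \sum_(x : X)
    ((pW w * pXW w x)%:C *
     ((s.1.1.1 == w) && (t.1.1.1 == w) && (s.1.1.2 == x) && (t.1.1.2 == x))%:R *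
     rho x (s.1.2, s.2) (t.1.2, t.2)).

End Quantum.

(* Main.v *)
(* Both receivers decode sequentially: they project onto the typical
   subspace Q of the average output state and then test the conditionally typical
   projections of the codewords one after the other.  A noncommutative union bound
   controls the error by the sum of the failure probabilities of the single tests.
   The code is a random superposition code: cloud centres w^n(m) for the common
   message and satellites x^n(m_1, m) for the personal one; receiver 2 tests cloud
   centres, receiver 1 satellites.  For receiver 1 the output state is first smoothed
   by the projection G_w onto the typical subspace of the state given w^n: then a wrong
   satellite of the right cloud costs 2^(-n H(B_1|W)) 2^(n H(B_1|X)), and, since
   G_w commutes with the state given w^n, a satellite of a wrong cloud costs
   2^(-n H(B_1)) 2^(n H(B_1|X)).  Typicality only needs one-sided bounds on products of
   eigenvalues, which follow from a Chernoff bound. *)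
Require Import Defs.
From HB Require Import structures.
From mathcomp Require Import all_boot all_order all_algebra.
From mathcomp Require Import all_classical all_reals.
From mathcomp Require Import sequences exp.
From mathcomp Require Import ring lra.
From mathcomp.real_closed Require Import complex.
Import Order.TTheory GRing.Theory Num.Theory.
Local Open Scope ring_scope.
Local Open Scope complex_scope.

Set Implicit Arguments.
Unset Strict Implicit.
Unset Printing Implicit Defensive.

(** * Positive operators and the sequential decoder *)

Section ComplexMatrices.
Variable R : realType.
Local Notation C := (R[i])%type.

(** Three obstacles shape the estimates. [G] depends on the transmitted centre, so it cannot belong
    to a measurement; it enters only by comparing the product of the tests applied to [Q] with the
    same product applied to [Q *m G]. Passing from a disturbed state to a success probability would
    normally cost a square root; here a free parameter [t] replaces it, so every bound stays linear
    in the quantities averaged over the random code. Finally, one codebook must suit both receivers,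
    so it is the sum of their two error probabilities that is averaged. Receiver 1 searches for the
    pair (m_1, m) jointly, which is why its side constrains only R_1 and R_1 + R. One-sided
    typicality is enough because each projection has one task: those attached to averaged states
    must cap the eigenvalues from above, those attached to codewords must have small rank, hence
    keep only eigenvalues bounded from below. Rates on the boundary of the region are covered
    because the code runs [delta] below them, and this slack exceeds the typicality margins. *)

Definition adjmx m n (A : 'M[C]_(m, n)) : 'M[C]_(n, m) := (map_mx conjc A)^T.

Lemma adjmxE m n (A : 'M[C]_(m, n)) i j : adjmx A i j = conjc (A j i).
Proof. by rewrite !mxE. Qed.

Lemma adjmxK m n (A : 'M[C]_(m, n)) : adjmx (adjmx A) = A.
Proof. by apply/matrixP => i j; rewrite !adjmxE conjcK. Qed.

Lemma adjmxM m n p (A : 'M[C]_(m, n)) (B : 'M[C]_(n, p)) :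
  adjmx (A *m B) = adjmx B *m adjmx A.
Proof. by rewrite /adjmx map_mxM trmx_mul. Qed.

Lemma adjmxD m n (A B : 'M[C]_(m, n)) : adjmx (A + B) = adjmx A + adjmx B.
Proof. by rewrite /adjmx map_mxD linearD. Qed.

Lemma adjmxN m n (A : 'M[C]_(m, n)) : adjmx (- A) = - adjmx A.
Proof. by rewrite /adjmx map_mxN linearN. Qed.

Lemma adjmxB m n (A B : 'M[C]_(m, n)) : adjmx (A - B) = adjmx A - adjmx B.
Proof. by rewrite adjmxD adjmxN. Qed.

Lemma adjmx1 n : adjmx (1%:M : 'M[C]_n) = 1%:M.
Proof. by rewrite /adjmx map_mx1 trmx1. Qed.

Lemma adjmx0 m n : adjmx (0 : 'M[C]_(m, n)) = 0.
Proof. by rewrite /adjmx map_mx0 trmx0. Qed.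

Definition re (x : C) : R := complex.Re x.

Lemma ReD (x y : C) : re (x + y) = re x + re y.
Proof. by case: x y => [a b] [c d]. Qed.

Lemma ReN (x : C) : re (- x) = - re x.
Proof. by case: x. Qed.

Lemma Re_sum (I : Type) (r : seq I) (P : pred I) (F : I -> C) :
  re (\sum_(i <- r | P i) F i) = \sum_(i <- r | P i) re (F i).
Proof. by apply: (big_morph _ ReD). Qed.

Lemma Re_scale (a : R) (x : C) : re (a%:C * x) = a * re x.
Proof. by case: x => b c /=; rewrite mul0r subr0. Qed.

Lemma Re_conjc (x : C) : re (conjc x) = re x.
Proof. by case: x. Qed.

Lemma Re_ge0 (x : C) : 0 <= x -> 0 <= re x.
Proof. by rewrite lecE => /andP[]. Qed.

Definition rtr n (A : 'M[C]_n) : R := re (\tr A).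

Lemma rtrD n (A B : 'M[C]_n) : rtr (A + B) = rtr A + rtr B.
Proof. by rewrite /rtr linearD ReD. Qed.

Lemma rtrN n (A : 'M[C]_n) : rtr (- A) = - rtr A.
Proof. by rewrite /rtr linearN ReN. Qed.

Lemma rtrB n (A B : 'M[C]_n) : rtr (A - B) = rtr A - rtr B.
Proof. by rewrite rtrD rtrN. Qed.

Lemma rtr0 n : rtr (0 : 'M[C]_n) = 0.
Proof. by rewrite /rtr linear0. Qed.

Lemma rtrZ n (a : R) (A : 'M[C]_n) : rtr (a%:C *: A) = a * rtr A.
Proof. by rewrite /rtr linearZ Re_scale. Qed.

Lemma rtr_sum n (I : Type) (r : seq I) (P : pred I) (F : I -> 'M[C]_n) :
  rtr (\sum_(i <- r | P i) F i) = \sum_(i <- r | P i) rtr (F i).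
Proof. by rewrite /rtr linear_sum Re_sum. Qed.

Lemma rtr_mulC m n (A : 'M[C]_(m, n)) (B : 'M[C]_(n, m)) :
  rtr (A *m B) = rtr (B *m A).
Proof. by rewrite /rtr mxtrace_mulC. Qed.

Lemma rtr_adj n (A : 'M[C]_n) : rtr (adjmx A) = rtr A.
Proof.
rewrite /rtr /mxtrace !Re_sum; apply: eq_bigr => i _.
by rewrite adjmxE Re_conjc.
Qed.

Definition psdmx n (A : 'M[C]_n) : Prop :=
  forall v : 'rV[C]_n, 0 <= (v *m A *m adjmx v) 0 0.

Lemma psdmxD n (A B : 'M[C]_n) : psdmx A -> psdmx B -> psdmx (A + B).
Proof.
by move=> hA hB v; rewrite mulmxDr mulmxDl mxE addr_ge0.
Qed.

Lemma psdmx0 n : psdmx (0 : 'M[C]_n).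
Proof. by move=> v; rewrite mulmx0 mul0mx mxE. Qed.

Lemma psdmx_conj m n (A : 'M[C]_n) (M : 'M[C]_(m, n)) :
  psdmx A -> psdmx (M *m A *m adjmx M).
Proof. by move=> hA v; have := hA (v *m M); rewrite adjmxM !mulmxA. Qed.

Lemma psdmx1 n : psdmx (1%:M : 'M[C]_n).
Proof.
move=> v; rewrite mulmx1 mxE sumr_ge0 // => i _.
by rewrite adjmxE mulcJ_ge0.
Qed.

Lemma psdmx_gram m n (M : 'M[C]_(m, n)) : psdmx (adjmx M *m M).
Proof. by have := psdmx_conj (adjmx M) (@psdmx1 m); rewrite mulmx1 adjmxK. Qed.

Lemma psdmx_diag_ge0 n (A : 'M[C]_n) i : psdmx A -> 0 <= A i i.
Proof.
move=> hA; have := hA (delta_mx 0 i).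
rewrite -rowE mxE (bigD1 i) //= big1 => [|j ji].
  by rewrite addr0 !mxE !eqxx conjc1 mulr1.
by rewrite !mxE (negPf ji) andbF conjc0 mulr0.
Qed.

Lemma psdmx_trace_ge0 n (A : 'M[C]_n) : psdmx A -> 0 <= \tr A.
Proof. by move=> hA; apply: sumr_ge0 => i _; apply: psdmx_diag_ge0. Qed.

Lemma psdmx_rtr_ge0 n (A : 'M[C]_n) : psdmx A -> 0 <= rtr A.
Proof. by move/psdmx_trace_ge0/Re_ge0. Qed.

(** Positivity makes the quadratic form real; reality at u + v and at u + iv gives the imaginary and
    the real part of conjugate symmetry, by polarization. *)
Lemma psdmx_hermitian n (A : 'M[C]_n) : psdmx A -> adjmx A = A.
Proof.
move=> hA.
pose f (u v : 'rV[C]_n) := (u *m A *m adjmx v) 0 0.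
have fD u v w z : f (u + v) (w + z) = f u w + f u z + f v w + f v z.
  have aE (B D : 'M[C]_1) : (B + D) 0 0 = B 0 0 + D 0 0 by rewrite mxE.
  by rewrite /f adjmxD !(mulmxDl, mulmxDr) !aE addrACA !addrA.
have hf u : complex.Im (f u u) = 0 by apply: ger0_Im; apply: hA.
have fi1 u v : f ('i *: u) v = 'i * f u v by rewrite /f -!scalemxAl mxE.
have fi2 u v : f u ('i *: v) = - 'i * f u v.
  rewrite /f /adjmx map_mxZ linearZ -scalemxAr mxE; congr (_ * _).
  by apply/eqP; rewrite eq_complex /= oppr0 !eqxx.
have sym u v : f v u = conjc (f u v).
  have := hf (u + v); rewrite fD.
  have := hf (u + 'i *: v); rewrite fD !fi1 !fi2.
  have := hf u; have := hf v.
  case: (f u u) (f v v) (f u v) (f v u) => [a b] [c d] [x y] [z t] /= -> ->.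
  move=> h1 h2; apply/eqP; rewrite eq_complex /=.
  by apply/andP; split; apply/eqP; lra.
apply/matrixP => i j; rewrite adjmxE.
have fE i' j' : f (delta_mx 0 i') (delta_mx 0 j') = A i' j'.
  rewrite /f -rowE mxE (bigD1 j') //= big1 => [|k kj].
    by rewrite addr0 !mxE !eqxx conjc1 mulr1.
  by rewrite !mxE (negPf kj) andbF conjc0 mulr0.
by rewrite -fE -sym fE.
Qed.

Definition projmx n (P : 'M[C]_n) : Prop := adjmx P = P /\ P *m P = P.

Lemma projmxC n (P : 'M[C]_n) : projmx P -> projmx (1%:M - P).
Proof.
case=> h1 h2; split; first by rewrite adjmxB adjmx1 h1.
by rewrite mulmxBr mulmx1 mulmxBl mul1mx h2 subrr subr0.
Qed.

Lemma projmx1 n : projmx (1%:M : 'M[C]_n).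
Proof. by split; [exact: adjmx1 | exact: mulmx1]. Qed.

Lemma projmx_psd n (P : 'M[C]_n) : projmx P -> psdmx P.
Proof. by case=> h1 h2; have := psdmx_gram P; rewrite h1 h2. Qed.

End ComplexMatrices.

Section SequentialDecoder.
Variables (R : realType) (d : nat).
Local Notation C := (R[i])%type.
Local Notation M := 'M[C]_d.

Ltac gen_atoms f :=
  repeat match goal with |- context [f ?a ?b] => generalize (f a b) end.

(* The squared seminorm of the semi-inner product Re tr(A rho B^* ) on operators:
   it treats a mixed state [rho] as if it were a vector, the operators [A] acting
   on it from the left. *)
Definition sqn (rho A : M) : R := rtr (A *m rho *m adjmx A).

Section Seminorm.
Variable rho : M.
Hypothesis psd_rho : psdmx rho.
Definition ip_state (A B : M) : R := rtr (A *m rho *m adjmx B).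

Let ipDl A B D : ip_state (A + B) D = ip_state A D + ip_state B D.
Proof. by rewrite /ip_state !mulmxDl rtrD. Qed.

Let ipDr A B D : ip_state A (B + D) = ip_state A B + ip_state A D.
Proof. by rewrite /ip_state adjmxD !mulmxDr rtrD. Qed.

Let ipNl A B : ip_state (- A) B = - ip_state A B.
Proof. by rewrite /ip_state !mulNmx rtrN. Qed.

Let ipNr A B : ip_state A (- B) = - ip_state A B.
Proof. by rewrite /ip_state adjmxN !mulmxN rtrN. Qed.

Let ipC A B : ip_state A B = ip_state B A.
Proof.
by rewrite /ip_state -[LHS]rtr_adj !adjmxM adjmxK (psdmx_hermitian psd_rho) mulmxA.
Qed.

Let ip_proj P A B : projmx P -> ip_state (P *m A) B = ip_state A (P *m B).
Proof.
by case=> h _; rewrite /ip_state adjmxM h -!mulmxA rtr_mulC !mulmxA.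
Qed.

Lemma sqn_ge0 A : 0 <= sqn rho A.
Proof. by apply: psdmx_rtr_ge0; apply: psdmx_conj. Qed.

Let sqnE A : sqn rho A = ip_state A A. Proof. exact: erefl. Qed.

Lemma sqnN A : sqn rho (- A) = sqn rho A.
Proof. by rewrite !sqnE ipNl ipNr opprK. Qed.

Lemma sqnD_le A B : sqn rho (A + B) <= 2 * sqn rho A + 2 * sqn rho B.
Proof.
have := sqn_ge0 (A - B); rewrite !sqnE !(ipDl, ipDr, ipNl, ipNr).
rewrite (ipC B A); gen_atoms ip_state; intros; lra.
Qed.

Lemma sqnD3_le (A B D : M) :
  sqn rho (A + (- B + D)) <= 2 * sqn rho A + 4 * sqn rho B + 4 * sqn rho D.
Proof.
have h1 : sqn rho (A + (- B + D)) <= 2 * sqn rho A + 2 * sqn rho (- B + D).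
  exact: sqnD_le.
have h2 : sqn rho (- B + D) <= 2 * sqn rho B + 2 * sqn rho D.
  by rewrite -(sqnN B); exact: sqnD_le.
by move: h1 h2; gen_atoms sqn; intros; lra.
Qed.

(** Positivity of the seminorm at t A + (B - A) bounds the cross term. This is Cauchy-Schwarz with
    the square root traded for [t], so the result can be averaged and [t] fixed at the very end. *)
Lemma sqn_sub_le A B (t : R) : 0 < t ->
  sqn rho A - sqn rho B <= t * sqn rho A + t^-1 * sqn rho (B - A).
Proof.
move=> t0; have ipZl (a : R) X Y : ip_state (a%:C *: X) Y = a * ip_state X Y.
  by rewrite /ip_state -!scalemxAl rtrZ.
have ipZr (a : R) X Y : ip_state X (a%:C *: Y) = a * ip_state X Y by rewrite ipC ipZl ipC.
have [D ->] : exists D, B = D + A by exists (B - A); rewrite subrK.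
have := sqn_ge0 (t%:C *: A + D); rewrite addrK.
rewrite !sqnE !(ipDl, ipDr, ipZl, ipZr) (ipC D A) => h.
have : 0 <= t^-1 * (t * (t * ip_state A A) + t * ip_state A D + (t * ip_state A D + ip_state D D)).
  rewrite mulr_ge0 ?invr_ge0 ?(ltW t0) //; move: h; gen_atoms ip_state; intros; lra.
have := sqn_ge0 D; rewrite sqnE !mulrDr !mulKf ?gt_eqF //.
gen_atoms ip_state; intros; lra.
Qed.

Lemma sqn_split P A : projmx P ->
  sqn rho A = sqn rho (P *m A) + sqn rho ((1%:M - P) *m A).
Proof.
move=> hP; have [_ PP] := hP.
rewrite !sqnE mulmxBl mul1mx !(ipDl, ipDr, ipNl, ipNr).
rewrite (ipC A (P *m A)) !(ip_proj _ _ hP) mulmxA PP; gen_atoms ip_state; intros; lra.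
Qed.

Lemma sqn_proj P A : projmx P -> sqn rho (P *m A) <= sqn rho A.
Proof. by move=> hP; rewrite [leRHS](sqn_split _ hP) lerDl sqn_ge0. Qed.

Variable S : nat -> M.
Hypothesis projS : forall j, projmx (S j).

Fixpoint chain (A : M) (k : nat) : M :=
  if k is k'.+1 then S k' *m chain A k' else A.

Lemma chainB A B k : chain (A - B) k = chain A k - chain B k.
Proof. by elim: k => //= k ->; rewrite mulmxBr. Qed.

Lemma sqn_chain A k : sqn rho (chain A k) <= sqn rho A.
Proof. by elim: k => [|k IH]; [exact: lexx | exact: le_trans (sqn_proj _ _) IH]. Qed.

(* Writing A_k for [chain A k], one has <A, A_k - A_(k+1)> =
   <(1 - S_k) A, (1 - S_k) A_k>, and |(1 - S_k) A_k|^2 = |A_k|^2 - |A_(k+1)|^2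
   telescopes; the AM-GM inequality then makes the two telescoping sums cancel. *)
Lemma union_bound A k :
  sqn rho (A - chain A k) <= \sum_(j < k) sqn rho ((1%:M - S j) *m A).
Proof.
suff H : 2 * ip_state A (A - chain A k) <=
    \sum_(j < k) sqn rho ((1%:M - S j) *m A) + sqn rho A - sqn rho (chain A k).
  move: H; rewrite !sqnE !(ipDl, ipDr, ipNl, ipNr).
  rewrite (ipC (chain A k) A); gen_atoms ip_state; intros; lra.
elim: k => [|k IH] /=.
  by rewrite big_ord0 subrr /ip_state adjmx0 mulmx0 rtr0 mulr0 add0r subrr.
rewrite big_ord_recr /=.
set D := chain A k in IH *; set E := S k.
have hE := projmxC (projS k); rewrite -/E in hE.
have -> : A - E *m D = (A - D) + (1%:M - E) *m D.
  by rewrite mulmxBl mul1mx addrA subrK.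
rewrite ipDr.
have -> : ip_state A ((1%:M - E) *m D) = ip_state ((1%:M - E) *m A) ((1%:M - E) *m D).
  by rewrite ip_proj // mulmxA hE.2.
have h1 := sqn_ge0 ((1%:M - E) *m A - (1%:M - E) *m D).
have h2 := sqn_split D (projS k); rewrite -/E in h2.
move: h1 h2 IH; set U := _ *m A; set V := _ *m D.
rewrite !sqnE !(ipDl, ipDr, ipNl, ipNr) (ipC V U).
move: (\sum_(_ < _) _) => x; gen_atoms ip_state; intros; lra.
Qed.

End Seminorm.

Lemma eq_chain (S S' : nat -> M) A k :
  (forall j, (j < k)%N -> S j = S' j) -> chain S A k = chain S' A k.
Proof.
elim: k => //= k IH h; rewrite h // IH // => j jk; apply: h.
exact: ltnW.
Qed.

(** The defect of the test sequence splits into the smoothing error Q - Q G carried through the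
    contracting chain, the disturbance of Q G by the tests (union bound), and Q G - 1. Repeated use
    of |A + B|^2 <= 2 |A|^2 + 2 |B|^2 gives coefficients 26, 24 and 8 for G, Q and the correct test;
    26 covers all three. *)
Lemma sqn_decoding_error (p : nat -> M) (Q G rho : M) (k : nat) :
  (forall j, projmx (p j)) -> projmx Q -> projmx G -> psdmx rho ->
  sqn rho (p k *m chain (fun j => 1%:M - p j) Q k - 1%:M) <=
    26 * (sqn rho (1%:M - G) + sqn rho (1%:M - Q) + sqn rho (1%:M - p k))
    + 4 * \sum_(j < k) sqn rho (p j *m Q *m G).
Proof.
move=> hp hQ hG hrho.
(* Acceptance by the correct test counts as one more projection after the rejections, so a single
   union bound covers both. *)
pose S j := if j == k then p k else 1%:M - p j.
have hS j : projmx (S j) by rewrite /S; case: ifP => _ //; apply: projmxC.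
have chE B : chain S B k.+1 = p k *m chain (fun j => 1%:M - p j) B k.
  rewrite /= {1}/S eqxx; congr (_ *m _); apply: eq_chain => j jk.
  by rewrite /S ltn_eqF.
rewrite -chE; set D := chain S (Q *m G) k.+1.
have hfirst : sqn rho (chain S (Q - Q *m G) k.+1) <= sqn rho (1%:M - G).
  apply: le_trans (sqn_chain hrho hS _ _) _.
  by rewrite -{1}(mulmx1 Q) -mulmxBr; apply: sqn_proj.
have he : sqn rho (Q *m G - 1%:M) <=
    2 * sqn rho (1%:M - G) + 2 * sqn rho (1%:M - Q).
  have -> : Q *m G - 1%:M = - (Q *m (1%:M - G) + (1%:M - Q)).
    by rewrite mulmxBr mulmx1 opprD !opprB addrA subrK.
  rewrite (sqnN hrho); apply: le_trans (sqnD_le hrho _ _) _.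
  by rewrite lerD2r ler_pM2l // sqn_proj.
have hmid : sqn rho (chain S Q k.+1 - 1%:M) <= 2 * sqn rho (1%:M - G)
    + 4 * sqn rho (Q *m G - D) + 4 * sqn rho (Q *m G - 1%:M).
  have -> : chain S Q k.+1 - 1%:M = chain S (Q - Q *m G) k.+1
      + (- (Q *m G - D) + (Q *m G - 1%:M)).
    by rewrite chainB -/D opprB !addrA subrK subrK.
  apply: le_trans (sqnD3_le hrho _ _ _) _.
  by rewrite !lerD2r ler_pM2l.
have hlast : sqn rho ((1%:M - p k) *m (Q *m G)) <=
    2 * sqn rho (1%:M - p k) + 2 * sqn rho (Q *m G - 1%:M).
  have -> : (1%:M - p k) *m (Q *m G)
      = (1%:M - p k) + (1%:M - p k) *m (Q *m G - 1%:M).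
    by rewrite [in RHS]mulmxBr mulmx1 [RHS]addrC subrK.
  apply: le_trans (sqnD_le hrho _ _) _.
  by rewrite lerD2l ler_pM2l // sqn_proj //; apply: projmxC.
have ub : sqn rho (Q *m G - D) <= \sum_(j < k) sqn rho (p j *m Q *m G)
    + sqn rho ((1%:M - p k) *m (Q *m G)).
  apply: le_trans (union_bound hrho hS (Q *m G) k.+1) _.
  rewrite big_ord_recr; apply: lerD; last by rewrite /S eqxx lexx.
  apply: ler_sum => j _; rewrite /S (ltn_eqF (ltn_ord j)).
  by rewrite opprB addrC subrK !mulmxA.
have z0 : 0 <= sqn rho (1%:M - Q) by exact: sqn_ge0.
have q0 : 0 <= sqn rho (1%:M - p k) by exact: sqn_ge0.
apply: (le_trans hmid); move: z0 q0 ub hlast he.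
move: (\sum_(_ < _) _) => x; gen_atoms sqn; clear -R d; intros; lra.
Qed.

(* [L i] first measures [Q], then the [P j] one after the other, and decodes to the
   first [i] whose test succeeds; it does not depend on [G], which only smooths the
   state in the error analysis. *)
Lemma sequential_decoder (I : finType) (i0 : I) (Q : M) (P : I -> M) :
  projmx Q -> (forall i, projmx (P i)) ->
  exists L : I -> M,
  [/\ forall i, psdmx (L i), \sum_i L i = 1%:M &
    forall i rho G (t : R), psdmx rho -> projmx G -> 0 < t ->
      rtr rho - rtr (L i *m rho) <= t * rtr rho + t^-1 *
        (26 * (sqn rho (1%:M - G) + sqn rho (1%:M - Q) + sqn rho (1%:M - P i))
         + 4 * \sum_(j | j != i) sqn rho (P j *m Q *m G))].
Proof.
move=> hQ hP.
pose N := #|I|.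
pose p k : M := P (nth i0 (enum I) k).
have hp k : projmx (p k) by exact: hP.
pose S k : M := 1%:M - p k.
have hS k : projmx (S k) by exact: projmxC.
pose K k := chain S Q k.
(* The weight of the outcomes where [Q] fails or every test rejects. It is assigned to index 0 to
   complete the measurement, which can only raise the success probability there. *)
pose rest := 1%:M - Q + adjmx (K N) *m K N.
pose L k := adjmx (p k *m K k) *m (p k *m K k) + (if k == 0%N then rest else 0).
have psd_rest : psdmx rest.
  by apply: psdmxD; [apply/projmx_psd/projmxC | apply: psdmx_gram].
(* Since [p n] and its complement are orthogonal projections, each accepted part is the drop from
   one surviving part to the next. *)
have tele n : \sum_(k < n) adjmx (p k *m K k) *m (p k *m K k)
      = Q - adjmx (K n) *m K n.
  elim: n => [|n IH]; first by rewrite big_ord0 /K /= hQ.1 hQ.2 subrr.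
  rewrite big_ord_recr /= IH /S !adjmxM (hp n).1.
  have -> : adjmx (1%:M - p n) = 1%:M - p n by rewrite (projmxC (hp n)).1.
  rewrite !mulmxA -(mulmxA _ (p n) (p n)) (hp n).2.
  rewrite -(mulmxA _ (1%:M - p n)) (projmxC (hp n)).2 mulmxBr mulmxBl mulmx1.
  by rewrite -/(K n) -addrA; congr (_ + _); rewrite opprB addrC.
exists (fun i => L (enum_rank i)); split.
- move=> i; apply: psdmxD; first exact: psdmx_gram.
  by case: ifP => _; [exact: psd_rest | exact: psdmx0].
- rewrite (reindex (@enum_val I I)); last first.
    by exists enum_rank => x _; rewrite ?enum_valK ?enum_rankK.
  under eq_bigr do rewrite enum_valK /L.
  rewrite big_split /= tele.
  have Npos : (0 < N)%N by apply/card_gt0P; exists i0.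
  rewrite (bigD1 (Ordinal Npos)) //= big1; last first.
    by move=> k; rewrite -val_eqE /= => /negPf ->.
  by rewrite addr0 /rest [1%:M - Q + _]addrC addrA subrK addrC subrK.
move=> i rho G t hrho hG t0.
have pi : p (enum_rank i) = P i.
  by rewrite /p -enum_val_nth enum_rankK.
pose k := val (enum_rank i).
pose v := p k *m K k.
have succ : rtr (L k *m rho) >= sqn rho v.
  have -> : sqn rho v = rtr (adjmx v *m v *m rho).
    by rewrite /sqn rtr_mulC !mulmxA.
  rewrite /L mulmxDl rtrD -/v lerDl.
  case: eqP => _; last by rewrite mul0mx rtr0.
  rewrite /rest mulmxDl rtrD addr_ge0 //.
    have := sqn_ge0 hrho (1%:M - Q); rewrite /sqn rtr_mulC mulmxA.
    by rewrite (projmxC hQ).1 (projmxC hQ).2.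
  by have := sqn_ge0 hrho (K N); rewrite /sqn rtr_mulC mulmxA.
have sq1 : sqn rho 1%:M = rtr rho by rewrite /sqn adjmx1 mul1mx mulmx1.
(* The success probability is at least the squared seminorm of [v], while that of the identity is
   the trace of [rho]. *)
have amgm := sqn_sub_le hrho 1%:M v t0; rewrite sq1 in amgm.
have {}amgm := le_trans (lerB (lexx (rtr rho)) succ) amgm.
apply: le_trans amgm _; rewrite lerD2l ler_pM2l ?invr_gt0 //.
apply: le_trans (sqn_decoding_error k hp hQ hG hrho) _.
rewrite {1}/k pi lerD2l ler_pM2l //.
have kN : (k <= N)%N by apply: ltnW; exact: ltn_ord.
rewrite (big_ord_widen N (fun j => sqn rho (p j *m Q *m G))) //.
rewrite [leRHS](reindex (@enum_val I I)); last first.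
  by exists enum_rank => x _; rewrite ?enum_valK ?enum_rankK.
rewrite [leRHS](eq_bigr (fun j : 'I_N => sqn rho (p j *m Q *m G))); last first.
  by move=> j _; rewrite /p -enum_val_nth.
rewrite [leRHS]big_mkcond [leLHS]big_mkcond; apply: ler_sum => j _.
case: ltnP => jk; last by case: ifP => _; [exact: sqn_ge0 | exact: lexx].
suff -> : enum_val j != i by [].
apply: contraTN jk => /eqP ji.
by rewrite /k -ji enum_valK ltnn.
Qed.

End SequentialDecoder.

(** * Random superposition codes *)

Section ProductWeights.
Variable R : realType.

Lemma sum_ffun_prod (I T : finType) (q : I -> T -> R) :
  \sum_(f : {ffun I -> T}) \prod_i q i (f i) = \prod_i \sum_t q i t.
Proof. by rewrite bigA_distr_bigA. Qed.

Lemma sum_ffun_prod1 (I T : finType) (q : I -> T -> R) :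
  (forall i, \sum_t q i t = 1) ->
  \sum_(f : {ffun I -> T}) \prod_i q i (f i) = 1.
Proof. by move=> hq; rewrite sum_ffun_prod big1. Qed.

Section Marginals.
Variables (I T : finType) (q : T -> R).
Hypothesis q1 : \sum_t q t = 1.

Lemma ffun_marginal (i : I) (h : T -> R) :
  \sum_(f : {ffun I -> T}) (\prod_j q (f j)) * h (f i) = \sum_t q t * h t.
Proof.
transitivity (\sum_(f : {ffun I -> T}) \prod_j
    (q (f j) * (if j == i then h (f j) else 1))).
  apply: eq_bigr => f _; rewrite big_split /=; congr (_ * _).
  by rewrite -big_mkcond big_pred1_eq.
rewrite (sum_ffun_prod (fun j t => q t * (if j == i then h t else 1))).
rewrite (bigD1 i) //= eqxx [X in _ * X]big1 ?mulr1 // => j /negPf ->.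
by under eq_bigr do rewrite mulr1.
Qed.

(** A function of two coordinates is not a product over coordinates. Summing over the value [s] of
    coordinate [j], pinned by an indicator, makes every summand one. *)
Lemma ffun_marginal2 (i j : I) (h : T -> T -> R) : i != j ->
  \sum_(f : {ffun I -> T}) (\prod_k q (f k)) * h (f i) (f j) =
  \sum_s q s * \sum_t q t * h t s.
Proof.
move=> ij; have ji : (j == i) = false by rewrite eq_sym (negPf ij).
transitivity (\sum_(f : {ffun I -> T}) \sum_s \prod_k (q (f k) *
   (if k == i then h (f k) s else if k == j then (f k == s)%:R else 1))).
  apply: eq_bigr => f _; rewrite (bigD1 (f j)) //= [X in _ + X]big1.
    rewrite addr0 big_split /=; congr (_ * _).
    rewrite (bigD1 i) //= eqxx (bigD1 j) /= ?ji // !eqxx.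
    by rewrite mul1r big1 ?mulr1 // => k /andP[/negPf -> /negPf ->].
  move=> s sj; rewrite (bigD1 j) //= ji eqxx.
  by rewrite eq_sym (negPf sj) mulr0 mul0r.
rewrite exchange_big; apply: eq_bigr => s _.
rewrite (sum_ffun_prod (fun k t => q t *
   (if k == i then h t s else if k == j then (t == s)%:R else 1))).
rewrite (bigD1 i) //= eqxx (bigD1 j) /= ?ji // eqxx.
rewrite [X in _ * (_ * X)]big1 => [|k /andP[/negPf -> /negPf ->]]; last first.
  by under eq_bigr do rewrite mulr1.
rewrite mulr1 mulrC; congr (_ * _).
rewrite (bigD1 s) //= eqxx mulr1 big1 ?addr0 // => t /negPf ->.
by rewrite mulr0.
Qed.

End Marginals.

Lemma exists_le_mean (T : finType) (q F : T -> R) (a : R) :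
  (forall t, 0 <= q t) -> \sum_t q t = 1 -> \sum_t q t * F t <= a ->
  exists t, F t <= a.
Proof.
move=> q0 q1 h; apply: contrapT => /forallNP hF.
have {}hF t : a < F t by rewrite ltNge; apply/negP.
have [t qt] : exists t, 0 < q t.
  apply: contrapT => /forallNP hq.
  have : \sum_t q t = 0.
    apply: big1 => t _; apply/eqP; rewrite eq_le q0 andbT leNgt.
    exact/negP/hq.
  by rewrite q1 => /eqP; rewrite oner_eq0.
have : a < \sum_t q t * F t.
  rewrite -[a]mul1r -q1 mulr_suml (bigD1 t) //= [ltRHS](bigD1 t) //=.
  apply: ltr_leD; rewrite ?ltr_pM2l ?hF //.
  by apply: ler_sum => s _; rewrite ler_wpM2l ?q0 ?ltW ?hF.
by rewrite ltNge h.
Qed.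

End ProductWeights.

Section RandomSuperpositionCode.
Variables (R : realType) (TW TX I1 I2 : finType).
Variables (pw : TW -> R) (px : TW -> TX -> R).
Hypotheses (pw0 : forall w, 0 <= pw w) (pw1 : \sum_w pw w = 1).
Hypotheses (px0 : forall w x, 0 <= px w x) (px1 : forall w, \sum_x px w x = 1).

(** A centre together with all its satellites forms one random letter. The code is then an i.i.d.
    family over [I2], and marginals of one or two coordinates compute every mean. *)
Let cloud : finType := (TW * {ffun I1 -> TX})%type.
Let qc (u : cloud) : R := pw u.1 * \prod_i px u.1 (u.2 i).

Let qc0 u : 0 <= qc u.
Proof. by rewrite mulr_ge0 // prodr_ge0. Qed.

Let qc_sum (h : TW -> {ffun I1 -> TX} -> R) : \sum_u qc u * h u.1 u.2 =
  \sum_w pw w * \sum_(c : {ffun I1 -> TX}) (\prod_i px w (c i)) * h w c.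
Proof.
rewrite -(pair_bigA _ (fun w c => qc (w, c) * h w c)) /=.
by apply: eq_bigr => w _; rewrite mulr_sumr; apply: eq_bigr => c _; rewrite -mulrA.
Qed.

Let qc1 : \sum_u qc u = 1.
Proof.
have := qc_sum (fun _ _ => 1); under eq_bigr do rewrite mulr1; move=> ->.
rewrite -[RHS]pw1; apply: eq_bigr => w _.
under eq_bigr do rewrite mulr1.
by rewrite (sum_ffun_prod1 (q := fun=> px w)) ?mulr1.
Qed.

Let qc_marg (i : I1) (h : TW -> TX -> R) :
  \sum_u qc u * h u.1 (u.2 i) = \sum_w pw w * \sum_x px w x * h w x.
Proof.
rewrite (qc_sum (fun w c => h w (c i))); apply: eq_bigr => w _.
by rewrite ffun_marginal.
Qed.

Let qc_marg2 (i j : I1) (h : TW -> TX -> TX -> R) : i != j ->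
  \sum_u qc u * h u.1 (u.2 i) (u.2 j) =
  \sum_w pw w * \sum_y px w y * \sum_x px w x * h w x y.
Proof.
move=> ij; rewrite (qc_sum (fun w c => h w (c i) (c j))).
by apply: eq_bigr => w _; rewrite ffun_marginal2.
Qed.

Variables (a : TW -> TX -> R) (b : TW -> TX -> TX -> R) (b' : TW -> TX -> TW -> R).
Variables (A B B2 B3 : R).
Hypothesis ha : \sum_w pw w * \sum_x px w x * a w x <= A.
Hypothesis hb : forall w y, \sum_x px w x * b w x y <= B.
Hypothesis hb2 : forall y, \sum_w pw w * \sum_x px w x * b w x y <= B2.
Hypothesis hb3 : forall v, \sum_w pw w * \sum_x px w x * b' w x v <= B3.

Lemma mean_le (T : finType) (q F : T -> R) (c : R) :
  (forall t, 0 <= q t) -> \sum_t q t = 1 -> (forall t, F t <= c) ->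
  \sum_t q t * F t <= c.
Proof.
move=> q0 q1 hF; rewrite -[leRHS]mul1r -q1 mulr_suml.
by apply: ler_sum => t _; rewrite ler_wpM2l.
Qed.

Let cost (f : I2 -> TW) (g : I1 -> I2 -> TX) (i2 : I2) (i1 : I1) : R :=
  a (f i2) (g i1 i2) +
  \sum_(j1 | j1 != i1) b (f i2) (g i1 i2) (g j1 i2) +
  \sum_(j2 | j2 != i2) \sum_j1 b (f i2) (g i1 i2) (g j1 j2) +
  \sum_(j2 | j2 != i2) b' (f i2) (g i1 i2) (f j2).

(* The three kinds of wrong codewords: same cloud, other cloud, and (for the second
   receiver) other cloud centre. *)
Lemma random_superposition_code :
  exists (f : I2 -> TW) (g : I1 -> I2 -> TX),
  \sum_i2 \sum_i1 (a (f i2) (g i1 i2) +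
    \sum_(j1 | j1 != i1) b (f i2) (g i1 i2) (g j1 i2) +
    \sum_(j2 | j2 != i2) \sum_j1 b (f i2) (g i1 i2) (g j1 j2) +
    \sum_(j2 | j2 != i2) b' (f i2) (g i1 i2) (f j2))
  <= (#|I2|%:R * #|I1|%:R) * (A + (#|I1|.-1)%:R * B
       + (#|I2|.-1)%:R * (#|I1|%:R * B2) + (#|I2|.-1)%:R * B3).
Proof.
pose Q (h : {ffun I2 -> cloud}) : R := \prod_k qc (h k).
have Q0 h : 0 <= Q h by exact: prodr_ge0.
have Q1 : \sum_h Q h = 1 by apply: (sum_ffun_prod1 (q := fun=> qc)).
have mean_sum (T : finType) (P : pred T) (F : {ffun I2 -> cloud} -> T -> R) (c : R) :
    (forall t, P t -> \sum_h Q h * F h t <= c) ->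
    \sum_h Q h * (\sum_(t | P t) F h t) <= #|P|%:R * c.
  move=> hc; under eq_bigr do rewrite mulr_sumr.
  rewrite exchange_big /=; apply: le_trans (_ : \sum_(t | P t) c <= _).
    exact: ler_sum.
  by rewrite sumr_const mulr_natl.
pose fw (h : {ffun I2 -> cloud}) i2 := (h i2).1.
pose gx (h : {ffun I2 -> cloud}) i1 i2 := (h i2).2 i1.
suff [h hh] : exists h, \sum_i2 \sum_i1 cost (fw h) (gx h) i2 i1 <=
    #|I2|%:R * (#|I1|%:R * (A + (#|I1|.-1)%:R * B
       + (#|I2|.-1)%:R * (#|I1|%:R * B2) + (#|I2|.-1)%:R * B3)).
  by exists (fw h), (gx h); move: hh; rewrite mulrA.
apply: (exists_le_mean Q0 Q1).
apply: (mean_sum) => i2 _; apply: (mean_sum) => i1 _.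
have split4 (F1 F2 F3 F4 : {ffun I2 -> cloud} -> R) c1 c2 c3 c4 :
    \sum_h Q h * F1 h <= c1 -> \sum_h Q h * F2 h <= c2 ->
    \sum_h Q h * F3 h <= c3 -> \sum_h Q h * F4 h <= c4 ->
    \sum_h Q h * (F1 h + F2 h + F3 h + F4 h) <= c1 + c2 + c3 + c4.
  move=> h1 h2 h3 h4; under eq_bigr do rewrite !mulrDr.
  by rewrite !big_split /=; apply: lerD => //; apply: lerD => //; apply: lerD.
(* In each wrong-codeword term the competitor is held fixed and the transmitted codeword is
   averaged. Inside a cloud both share the centre, so only the satellite is averaged; across clouds
   the centre is averaged as well, which produces the smaller bounds [B2] and [B3]. *)
apply: split4.
- rewrite (ffun_marginal qc1 i2 (fun u : cloud => a u.1 (u.2 i1))).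
  by rewrite qc_marg.
- rewrite -(cardC1 i1); apply: (mean_sum) => j1 j1i1.
  rewrite (ffun_marginal qc1 i2 (fun u : cloud => b u.1 (u.2 i1) (u.2 j1))).
  rewrite qc_marg2 1?eq_sym //; apply: mean_le => // w.
  by apply: mean_le.
- rewrite -(cardC1 i2); apply: (mean_sum) => j2 j2i2; apply: (mean_sum) => j1 _.
  rewrite (ffun_marginal2 qc1 (fun u v : cloud => b u.1 (u.2 i1) (v.2 j1))) 1?eq_sym //.
  apply: mean_le => // u.
  by rewrite (qc_marg i1 (fun w x => b w x (u.2 j1))).
- rewrite -(cardC1 i2); apply: (mean_sum) => j2 j2i2.
  rewrite (ffun_marginal2 qc1 (fun u v : cloud => b' u.1 (u.2 i1) v.1)) 1?eq_sym //.
  apply: mean_le => // u.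
  by rewrite (qc_marg i1 (fun w x => b' w x u.1)).
Qed.

End RandomSuperpositionCode.

(** * Large deviations *)

Section LargeDeviations.
Variables (R : realType) (Z B : finType) (P g : Z -> B -> R).
Hypotheses (P0 : forall z b, 0 <= P z b) (P1 : \sum_z \sum_b P z b = 1).
Hypothesis gneg : \sum_z \sum_b P z b * g z b < 0.

(** Inverting exp(-x) >= 1 - x leaves (1 + x + 2 x^2)(1 - x) = 1 + x^2 (1 - 2 x) >= 1. *)
Lemma expR_le_quadratic (x : R) : x <= 2^-1 -> expR x <= 1 + x + 2 * x ^+ 2.
Proof.
move=> hx; have h1 : 1 - x <= expR (- x) by have := expR_ge1Dx (- x).
have h0 : 0 < 1 - x by lra.
rewrite -[x in expR x]opprK expRN.
apply: (@le_trans _ _ (1 - x)^-1).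
  by rewrite lef_pV2 // posrE ?expR_gt0.
rewrite -[(1 - x)^-1]mul1r ler_pdivrMr //.
have : 0 <= x ^+ 2 * (1 - 2 * x) by rewrite mulr_ge0 ?sqr_ge0 //; lra.
lra.
Qed.

Let mgf : exists2 t, 0 < t & \sum_z \sum_b P z b * expR (t * g z b) < 1.
Proof.
(* [K] bounds |g| uniformly; the leading 1 keeps it positive for the divisions below. *)
pose K := 1 + \sum_z \sum_b `|g z b|.
have gK z b : `|g z b| <= K.
  rewrite /K (bigD1 z) //= (bigD1 b) //=.
  have h1 : 0 <= \sum_(i | i != b) `|g z i| by apply: sumr_ge0.
  have h2 : 0 <= \sum_(i | i != z) \sum_c `|g i c|.
    by apply: sumr_ge0 => i _; apply: sumr_ge0.
  by lra.
have K1 : 1 <= K.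
  by rewrite /K lerDl; apply: sumr_ge0 => z _; apply: sumr_ge0.
have m0 := gneg; set m := \sum_z \sum_b P z b * g z b in m0.
have mK : - m <= K.
  rewrite -[K]mul1r -P1 mulr_suml /m -sumrN; apply: ler_sum => z _.
  rewrite mulr_suml -sumrN; apply: ler_sum => b _.
  rewrite -mulrN ler_wpM2l //; apply: le_trans (gK z b).
  by rewrite -normrN ler_norm.
have K0 : 0 < K by lra.
(* With this choice t K <= 1/4, within the range of the quadratic bound, and the quadratic term 2 (t
   K)^2 = -t m / 2 consumes only half of the negative drift t m. *)
pose t := - m / (4 * K ^+ 2).
have t0 : 0 < t by rewrite divr_gt0 ?oppr_gt0 // mulr_gt0 // exprn_gt0.
have tK : t * K <= 4^-1.
  have -> : t * K = (- m / K) * 4^-1 by rewrite /t; field; lra.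
  by rewrite -[leRHS]mul1r ler_wpM2r ?invr_ge0 // ler_pdivrMr // mul1r.
exists t => //.
apply: (@le_lt_trans _ _ (1 + t * m + 2 * (t * K) ^+ 2)).
  have -> : 1 + t * m + 2 * (t * K) ^+ 2 =
      \sum_z \sum_b P z b * (1 + t * g z b + 2 * (t * K) ^+ 2).
    move: (2 * (t * K) ^+ 2) => c.
    under eq_bigr do (under eq_bigr do rewrite !mulrDr mulr1 mulrCA).
    under eq_bigr do rewrite !big_split /= -mulr_sumr -mulr_suml.
    by rewrite !big_split /= -mulr_sumr -mulr_suml P1 -/m mul1r.
  apply: ler_sum => z _; apply: ler_sum => b _; rewrite ler_wpM2l //.
  have tgK : `|t * g z b| <= t * K by rewrite normrM (gtr0_norm t0) ler_pM2l.
  apply: le_trans (expR_le_quadratic _) _.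
    by have := ler_norm (t * g z b); lra.
  rewrite lerD2l ler_pM2l // -real_normK ?num_real //.
  by rewrite lerXn2r // ?nnegrE ?normr_ge0 // mulr_ge0 // ltW.
have -> : 2 * (t * K) ^+ 2 = - (t * m) / 2.
  by rewrite /t; field; lra.
have : t * m < 0 by rewrite pmulr_rlt0.
lra.
Qed.

(** Exponential Markov inequality: the indicator of a nonnegative sum is at most exp(t sum g), whose
    mean factorizes into the n-th power of a one-letter constant below 1. *)
Lemma chernoff_bound : exists2 c, 0 <= c < 1 & forall n,
  \sum_(z : {ffun 'I_n -> Z}) \sum_(k : {ffun 'I_n -> B} | 0 <= \sum_i g (z i) (k i))
     \prod_i P (z i) (k i) <= c ^+ n.
Proof.
have [t t0 ht] := mgf.
exists (\sum_z \sum_b P z b * expR (t * g z b)).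
  rewrite ht andbT; apply: sumr_ge0 => z _; apply: sumr_ge0 => b _.
  by rewrite mulr_ge0 ?expR_ge0.
move=> n.
have -> : (\sum_z \sum_b P z b * expR (t * g z b)) ^+ n =
    \sum_(z : {ffun 'I_n -> Z}) \sum_(k : {ffun 'I_n -> B})
      \prod_i (P (z i) (k i) * expR (t * g (z i) (k i))).
  under [RHS]eq_bigr => z _ do
    rewrite (sum_ffun_prod (fun i b => P (z i) b * expR (t * g (z i) b))).
  rewrite (sum_ffun_prod (fun i z => \sum_b P z b * expR (t * g z b))).
  by rewrite prodr_const card_ord.
apply: ler_sum => z _; rewrite [leLHS]big_mkcond; apply: ler_sum => k _.
case: ifP => h.
  rewrite big_split /= ler_peMr ?prodr_ge0 // -expR_sum -mulr_sumr.
  by rewrite -expR0 ler_expR mulr_ge0 // ltW.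
by apply: prodr_ge0 => i _; rewrite mulr_ge0 ?expR_ge0.
Qed.

End LargeDeviations.

Lemma expr_eventually_le (R : realType) (c eps : R) : 0 <= c < 1 -> 0 < eps ->
  exists N, forall n, (N <= n)%N -> c ^+ n <= eps.
Proof.
move=> /andP[c0 c1] e0.
(* The logarithm is useless at c = 0; there N = 1 is needed because 0^0 = 1. *)
have [c00|cpos] : c = 0 \/ 0 < c.
  by move: c0; rewrite le_eqVlt => /orP[/eqP <-|]; [left|right].
  by exists 1%N => -[|n] // _; rewrite c00 expr0n ltW.
pose a := - ln c; have a0 : 0 < a by rewrite oppr_gt0 ln_lt0 // cpos.
pose N := Num.bound (eps^-1 / a).
exists N => n Nn.
have -> : c ^+ n = (expR (n%:R * a))^-1.
  by rewrite expRM_natl /a expRN lnK ?posrE // exprVn invrK.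
rewrite -[leRHS]invrK lef_pV2 ?posrE ?expR_gt0 ?invr_gt0 //.
apply: (@le_trans _ _ (n%:R * a)); last first.
  by apply: le_trans (expR_ge1Dx _); rewrite lerDr.
rewrite -ler_pdivrMr //; apply: (@le_trans _ _ N%:R); last by rewrite ler_nat.
apply: ltW; apply: archi_boundP.
by rewrite divr_ge0 ?invr_ge0 ?ltW.
Qed.

(** * Spectral calculus *)

Section SpectralCalculus.
Variable R : realType.
Local Notation C := (R[i])%type.

Lemma sum_enum_val (V : nmodType) (T : finType) (F : T -> V) :
  \sum_k F k = \sum_(j < #|T|) F (enum_val j).
Proof.
rewrite (reindex (@enum_val T T)); first exact: eq_bigl.
by exists enum_rank => x _; rewrite ?enum_valK ?enum_rankK.
Qed.

(** Functional calculus in the eigenbasis [U]: for a fixed unitary, operator identities and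
    inequalities reduce to pointwise ones between functions on [T]. *)
Definition spmx (T : finType) (U : op R T) (f : T -> R) : 'M[C]_#|T| :=
  opmx U *m diag_mx (\row_j (f (enum_val j))%:C) *m adjmx (opmx U).

Definition unitary (T : finType) (U : op R T) : Prop :=
  forall s t, \sum_k U s k * conjc (U t k) = (s == t)%:R.

Section Calculus.
Variables (T : finType) (U : op R T).
Hypothesis unitU : unitary U.

Lemma unitary_opmx : opmx U *m adjmx (opmx U) = 1%:M.
Proof.
apply/matrixP => i j; rewrite !mxE -(inj_eq enum_val_inj) -unitU.
rewrite [RHS]sum_enum_val.
by apply: eq_bigr => k _; rewrite adjmxE !mxE.
Qed.

Lemma unitary_adj_opmx : adjmx (opmx U) *m opmx U = 1%:M.
Proof. exact/mulmx1C/unitary_opmx. Qed.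

Lemma spmx_eq (f g : T -> R) : f =1 g -> spmx U f = spmx U g.
Proof.
by move=> fg; rewrite /spmx; congr (_ *m diag_mx _ *m _); apply/rowP => j; rewrite !mxE fg.
Qed.

Lemma spmxM (f g : T -> R) : spmx U f *m spmx U g = spmx U (fun k => f k * g k).
Proof.
rewrite /spmx !mulmxA -(mulmxA _ (adjmx _) (opmx U)) unitary_adj_opmx mulmx1.
rewrite -(mulmxA (opmx U) (diag_mx _) (diag_mx _)) mulmx_diag; congr (_ *m diag_mx _ *m _).
by apply/rowP => j; rewrite !mxE rmorphM.
Qed.

Lemma spmxB (f g : T -> R) : spmx U f - spmx U g = spmx U (fun k => f k - g k).
Proof.
rewrite /spmx -mulmxBl -mulmxBr -linearB /=; congr (_ *m diag_mx _ *m _).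
by apply/rowP => j; rewrite !mxE rmorphB.
Qed.

Lemma spmx_const (a : R) : spmx U (fun=> a) = a%:C%:M.
Proof.
rewrite /spmx; have -> : \row_(j < #|T|) a%:C = const_mx a%:C.
  by apply/rowP => j; rewrite !mxE.
by rewrite diag_const_mx mul_mx_scalar -scalemxAl unitary_opmx scalemx1.
Qed.

Lemma adj_spmx (f : T -> R) : adjmx (spmx U f) = spmx U f.
Proof.
rewrite /spmx !adjmxM adjmxK -!mulmxA; congr (_ *m (_ *m _)).
rewrite /adjmx map_diag_mx tr_diag_mx; congr diag_mx.
by apply/rowP => j; rewrite !mxE /= oppr0.
Qed.

Lemma rtr_spmx (f : T -> R) : rtr (spmx U f) = \sum_k f k.
Proof.
rewrite /spmx rtr_mulC mulmxA unitary_adj_opmx mul1mx /rtr mxtrace_diag Re_sum.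
rewrite [RHS]sum_enum_val.
by apply: eq_bigr => j _; rewrite !mxE.
Qed.

Lemma psdmx_spmx (f : T -> R) : (forall k, 0 <= f k) -> psdmx (spmx U f).
Proof.
move=> f0; apply: psdmx_conj => v.
rewrite mul_mx_diag mxE sumr_ge0 // => j _.
by rewrite adjmxE !mxE mulrAC mulr_ge0 ?mulcJ_ge0 // ler0c.
Qed.

Lemma projmx_spmx (S : pred T) : projmx (spmx U (fun k => (S k)%:R)).
Proof.
split; first exact: adj_spmx.
by rewrite spmxM; apply: spmx_eq => k; case: (S k); rewrite ?mulr1 ?mulr0.
Qed.

End Calculus.

Definition eigen_dec (T : finType) (A U : op R T) (d : T -> R) : Prop :=
  unitary U /\ forall s t, A s t = \sum_k U s k * (d k)%:C * conjc (U t k).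

Lemma eigen_dec_spmx (T : finType) (A U : op R T) (d : T -> R) :
  eigen_dec A U d -> opmx A = spmx U d.
Proof.
move=> [_ hA]; apply/matrixP => i j; rewrite !mxE hA.
rewrite sum_enum_val.
by apply: eq_bigr => k _; rewrite mul_mx_diag adjmxE !mxE.
Qed.

Lemma psd_psdmx (T : finType) (A : op R T) : psd A -> psdmx (opmx A).
Proof.
move=> hA v; have := hA (fun s => conjc (v 0 (enum_rank s))).
rewrite sum_enum_val.
rewrite exchange_big /= sum_enum_val.
congr (0 <= _); rewrite mxE; apply: eq_bigr => j _.
rewrite adjmxE mxE mulr_suml; apply: eq_bigr => i _.
by rewrite !enum_valK conjcK mxE.
Qed.

(** The spectral theorem for normal matrices. The eigenvalues are diagonal entries of P M P^*, hence
    nonnegative, so taking their real parts loses nothing. *)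
Lemma psd_eigen_dec (T : finType) (A : op R T) : psd A ->
  exists U d, eigen_dec A U d /\ forall k, 0 <= d k.
Proof.
move=> /psd_psdmx; set M := opmx A => hM.
have hermM : M \is hermsymmx.
  apply/is_hermitianmxP; rewrite expr0 scale1r -[LHS](psdmx_hermitian hM).
  by rewrite /adjmx map_trmx.
have /hermitian_normalmx/orthomx_spectralP := hermM.
set P := spectralmx M; set e := spectral_diag M.
have uP : P \is unitarymx by exact: spectral_unitarymx.
have adjP : invmx P = adjmx P by rewrite invmx_unitary // /adjmx map_trmx.
rewrite adjP => eqM.
have PP : P *m adjmx P = 1%:M.
  by rewrite -adjP mulmxV // unitarymx_unit.
have PP' := mulmx1C PP.
have e0 k : 0 <= e 0 k.
  have := psdmx_diag_ge0 k (psdmx_conj P hM).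
  rewrite eqM !mulmxA PP mul1mx -mulmxA PP mulmx1.
  by rewrite mxE eqxx mulr1n.
pose U : op R T := fun s t => conjc (P (enum_rank t) (enum_rank s)).
exists U, (fun k => re (e 0 (enum_rank k))); split; last first.
  by move=> k; apply: Re_ge0.
split=> [s t|s t].
  have /matrixP/(_ (enum_rank s) (enum_rank t)) := PP'.
  rewrite !mxE (inj_eq enum_rank_inj) => <-; rewrite [LHS]sum_enum_val.
  apply: eq_bigr => j _.
  by rewrite adjmxE /U enum_valK conjcK.
have -> : A s t = M (enum_rank s) (enum_rank t) by rewrite mxE !enum_rankK.
rewrite eqM mxE [RHS]sum_enum_val; apply: eq_bigr => j _.
rewrite mul_mx_diag !mxE /U !enum_valK conjcK; congr (_ * _ * _).
by rewrite [LHS]complexE (ger0_Im (e0 j)) mulr0 addr0.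
Qed.

Lemma eigen_dec_family (Z T : finType) (A : Z -> op R T) :
  (forall z, density (A z)) -> exists (U : Z -> op R T) (d : Z -> T -> R),
    (forall z, eigen_dec (A z) (U z) (d z)) /\ (forall z k, 0 <= d z k).
Proof.
move=> hA.
have /choice[f hf] : forall z, exists f : op R T * (T -> R),
    eigen_dec (A z) f.1 f.2 /\ forall b, 0 <= f.2 b.
  by move=> z; have [U [l h]] := psd_eigen_dec (hA z).1; exists (U, l).
exists (fun x => (f x).1), (fun x => (f x).2).
by split=> x; have [] := hf x.
Qed.

Lemma eigen_dec_psd (T : finType) (A U : op R T) (d : T -> R) :
  eigen_dec A U d -> (forall k, 0 <= d k) -> psdmx (opmx A).
Proof. by move=> h d0; rewrite (eigen_dec_spmx h); apply: psdmx_spmx. Qed.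

Lemma eigen_dec_char_poly (T : finType) (A U : op R T) (d : T -> R) :
  eigen_dec A U d -> char_poly (opmx A) = \prod_k ('X - (d k)%:C%:P).
Proof.
move=> h; have /(congr1 (map_mx polyC)) := unitary_opmx h.1.
rewrite map_mxM map_mx1; set V := map_mx _ _; set V' := map_mx _ _ => VV'.
have -> : char_poly (opmx A) = \det (V *m
    diag_mx (\row_j ('X - (d (enum_val j))%:C%:P)) *m V').
  rewrite /char_poly /char_poly_mx (eigen_dec_spmx h) /spmx !map_mxM.
  rewrite -/V -/V' map_diag_mx; congr (\det _).
  have -> : 'X%:M = V *m 'X%:M *m V'.
    by rewrite mul_mx_scalar -scalemxAl VV' scalemx1.
  rewrite -mulmxBl -mulmxBr -diag_const_mx -linearB /=.
  by congr (_ *m diag_mx _ *m _); apply/rowP => j; rewrite !mxE.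
rewrite !det_mulmx mulrAC -det_mulmx VV' det1 mul1r det_diag.
rewrite [RHS](reindex (@enum_val T T)); last first.
  by exists enum_rank => x _; rewrite ?enum_valK ?enum_rankK.
by apply: eq_bigr => j _; rewrite mxE.
Qed.

(** [entropy] uses a chosen list of eigenvalues. Any two lists with the same characteristic
    polynomial are permutations of each other, so any eigendecomposition computes it. *)
Lemma eigen_dec_entropy (T : finType) (A U : op R T) (d : T -> R) :
  eigen_dec A U d -> entropy A = - \sum_k d k * log2 (d k).
Proof.
move=> h; rewrite /entropy; congr (- _).
have spec : spectrum A [seq d k | k <- enum T].
  by rewrite /spectrum (eigen_dec_char_poly h) big_map big_enum.
have spec' := xgetPex [::] (ex_intro _ _ spec).
have : perm_eq [seq a%:C | a <- xget [::] (spectrum A)]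
               [seq a%:C | a <- [seq d k | k <- enum T]].
  by apply: prod_XsubC_eq; rewrite !(big_map (fun a => a%:C)) -spec' -spec.
move=> /(perm_map_inj (@complexI R)) hp.
by rewrite (perm_big _ hp) /= big_map big_enum.
Qed.

Lemma eigen_dec_trace (T : finType) (A U : op R T) (d : T -> R) :
  eigen_dec A U d -> \sum_k d k = re (trace A).
Proof.
move=> h; rewrite -(rtr_spmx h.1) -(eigen_dec_spmx h) /rtr; congr (re _).
rewrite /trace sum_enum_val.
by apply: eq_bigr => j _; rewrite mxE.
Qed.

Definition tensor_power (Z T : finType) (n : nat) (A : Z -> op R T)
  (z : 'I_n -> Z) : op R {ffun 'I_n -> T} :=
  fun s t => \prod_i A (z i) (s i) (t i).

Lemma tensor_power_eigen_dec (Z T : finType) (n : nat) (A U : Z -> op R T)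
  (d : Z -> T -> R) (z : 'I_n -> Z) : (forall z, eigen_dec (A z) (U z) (d z)) ->
  eigen_dec (tensor_power A z) (tensor_power U z) (fun k => \prod_i d (z i) (k i)).
Proof.
move=> h; split=> [s t|s t].
  under eq_bigr do rewrite /tensor_power rmorph_prod -big_split /=.
  rewrite -(bigA_distr_bigA (fun i k => U (z i) (s i) k * conjc (U (z i) (t i) k))).
  under eq_bigr do rewrite (h _).1.
  case: eqP => [->|st]; first by rewrite big1 // => i _; rewrite eqxx.
  have /existsP[i sti] : [exists i, s i != t i].
    rewrite -negb_forall; apply: contra_notN st => /forallP hst.
    by apply/ffunP => i; apply/eqP.
  by rewrite (bigD1 i) //= (negPf sti) mul0r.
under [RHS]eq_bigr do rewrite /tensor_power !rmorph_prod -!big_split /=.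
rewrite -(bigA_distr_bigA (fun i k =>
  U (z i) (s i) k * (d (z i) k)%:C * conjc (U (z i) (t i) k))).
by apply: eq_bigr => i _; rewrite (h _).2.
Qed.

End SpectralCalculus.

(** * Entropies of classical-quantum operators *)

Section Entropies.
Variable R : realType.
Local Notation C := (R[i])%type.

Definition shannon (T : finType) (q : T -> R) : R := - \sum_t q t * log2 (q t).

Definition mix (Z T : finType) (q : Z -> R) (A : Z -> op R T) : op R T :=
  fun s t => \sum_z (q z)%:C * A z s t.

Lemma eigen_dec_density_sum (T : finType) (A U : op R T) l :
  density A -> eigen_dec A U l -> \sum_b l b = 1.
Proof. by move=> [_ tA] /eigen_dec_trace ->; rewrite tA. Qed.

Lemma mix_density (Z T : finType) (q : Z -> R) (A : Z -> op R T) :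
  (forall z, 0 <= q z) -> \sum_z q z = 1 -> (forall z, density (A z)) ->
  density (mix q A).
Proof.
move=> q0 q1 hA; split=> [v|].
  have -> : \sum_s \sum_t conjc (v s) * mix q A s t * v t =
      \sum_z (q z)%:C * \sum_s \sum_t conjc (v s) * A z s t * v t.
    under [RHS]eq_bigr do rewrite mulr_sumr.
    rewrite [RHS]exchange_big; apply: eq_bigr => s _.
    under [RHS]eq_bigr do rewrite mulr_sumr.
    rewrite [RHS]exchange_big; apply: eq_bigr => t _.
    by rewrite /mix mulr_sumr mulr_suml; apply: eq_bigr => z _; ring.
  apply: sumr_ge0 => z _; rewrite mulr_ge0 ?ler0c //.
  exact: (hA z).1.
rewrite /trace /mix exchange_big /=.
transitivity (\sum_z (q z)%:C).
  apply: eq_bigr => z _; rewrite -mulr_sumr.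
  by have := (hA z).2; rewrite /trace => ->; rewrite mulr1.
by rewrite -rmorph_sum q1.
Qed.

Section Marginals.
Variables (T U V : finType) (k : T -> U) (d : T -> V) (mk : U -> V -> T).
Hypotheses (kmk : forall u v, k (mk u v) = u) (dmk : forall u v, d (mk u v) = v).
Hypothesis mkkd : forall t, mk (k t) (d t) = t.

(** With [mk] inverse to the coordinate pair, one set of lemmas serves every bracketing and ordering
    of the subsystems. *)
Lemma sum_coords (W : nmodType) (F : T -> W) :
  \sum_t F t = \sum_u \sum_v F (mk u v).
Proof.
rewrite pair_bigA /= (reindex (fun p : U * V => mk p.1 p.2)); last first.
  exists (fun t => (k t, d t)) => t _ /=; rewrite ?mkkd //.
  by rewrite kmk dmk -surjective_pairing.
exact: eq_bigl.
Qed.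

Lemma margE (A : op R T) u u' :
  marg k d A u u' = \sum_v A (mk u v) (mk u' v).
Proof.
rewrite /marg sum_coords (bigD1 u) //= [X in _ + X]big1 => [|w wu]; last first.
  apply: big1 => v _; apply: big1 => t _.
  by rewrite kmk (negPf wu) mul0r.
rewrite addr0; apply: eq_bigr => v _.
rewrite sum_coords (bigD1 u') //= [X in _ + X]big1 => [|w wu]; last first.
  apply: big1 => v' _.
  by rewrite !kmk (negPf wu) andbF mul0r.
rewrite addr0 (bigD1 v) //= [X in _ + X]big1 => [|v' vv]; last first.
  by rewrite !dmk [v == _]eq_sym (negPf vv) andbF mul0r.
by rewrite !kmk !dmk !eqxx mul1r addr0.
Qed.

(** The quadratic form of the marginal at [v] is the sum over [z] of the form of [A] at the copy of
    [v] placed in the slice d = z. *)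
Lemma marg_density (A : op R T) : density A -> density (marg k d A).
Proof.
move=> [pA tA]; split=> [v|]; last first.
  rewrite /trace -tA /trace [RHS]sum_coords.
  by apply: eq_bigr => u _; rewrite margE.
have -> : \sum_s \sum_t conjc (v s) * marg k d A s t * v t =
   \sum_z \sum_s \sum_t
     conjc ((d s == z)%:R * v (k s)) * A s t * ((d t == z)%:R * v (k t)).
  transitivity (\sum_z \sum_s \sum_t conjc (v s) * A (mk s z) (mk t z) * v t).
    rewrite [RHS]exchange_big; apply: eq_bigr => s _.
    rewrite [RHS]exchange_big; apply: eq_bigr => t _.
    by rewrite margE mulr_sumr mulr_suml.
  have reduce (z : V) (F : T -> C) : (forall t, d t != z -> F t = 0) ->
      \sum_t F t = \sum_u F (mk u z).
    move=> hF; rewrite sum_coords; apply: eq_bigr => u _.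
    by rewrite (bigD1 z) //= big1 ?addr0 // => v' v'z; rewrite hF ?dmk.
  apply: eq_bigr => z _; rewrite [RHS](reduce z); last first.
    move=> t tz; apply: big1 => s _.
    by rewrite (negPf tz) mul0r conjc0 !mul0r.
  apply: eq_bigr => s _; rewrite [RHS](reduce z); last first.
    by move=> t tz; rewrite (negPf tz) mul0r mulr0.
  by apply: eq_bigr => t _; rewrite !dmk !kmk !eqxx !mul1r.
by apply: sumr_ge0 => z _; exact: pA.
Qed.

End Marginals.

Lemma log2M (x y : R) : 0 < x -> 0 < y -> log2 (x * y) = log2 x + log2 y.
Proof. by move=> x0 y0; rewrite /log2 lnM ?posrE // mulrDl. Qed.

(* A classical-quantum operator whose classical and quantum coordinates on the
   index set [T] are [k] and [d]. *)
Lemma entropy_cq (T Z B : finType) (k : T -> Z) (d : T -> B) (mk : Z -> B -> T)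
    (kmk : forall z b, k (mk z b) = z) (dmk : forall z b, d (mk z b) = b)
    (mkkd : forall t, mk (k t) (d t) = t)
    (q : Z -> R) (A U : Z -> op R B) (lam : Z -> B -> R) (Theta : op R T) :
  (forall z, 0 <= q z) -> (forall z b, 0 <= lam z b) ->
  (forall z, \sum_b lam z b = 1) ->
  (forall z, eigen_dec (A z) (U z) (lam z)) ->
  (forall s t, Theta s t = (k s == k t)%:R * (q (k s))%:C * A (k s) (d s) (d t)) ->
  entropy Theta = shannon q + \sum_z q z * shannon (lam z).
Proof.
move=> q0 lam0 lam1 hA hTheta.
(* The block-diagonal eigenbasis: block [z] carries the eigenvectors of [A z], with eigenvalues
   multiplied by [q z]. *)
pose V : op R T := fun s t => (k s == k t)%:R * U (k s) (d s) (d t).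
have hV : eigen_dec Theta V (fun t => q (k t) * lam (k t) (d t)).
  have conjb (b : bool) : conjc (b%:R : C) = b%:R by rewrite conjc_nat.
  split=> [s t|s t]; rewrite (sum_coords kmk dmk mkkd) (bigD1 (k s)) //= [X in _ + X]big1
     => [|z zs]; try (apply: big1 => b _; rewrite /V kmk eq_sym (negPf zs) !mul0r //).
    rewrite addr0 /V; under eq_bigr do rewrite !kmk !dmk eqxx mul1r.
    case: (eqVneq (k s) (k t)) => [kst|nkst].
      have -> : (s == t) = (d s == d t).
        apply/eqP/eqP => [->//|dst].
        by rewrite -(mkkd s) -(mkkd t) kst dst.
      rewrite -(hA (k s)).1 kst; apply: eq_bigr => b _.
      by rewrite mul1r.
    rewrite big1 => [|b _]; last by rewrite mul0r conjc0 mulr0.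
    by have /contraNF -> // : s == t -> k s == k t by move=> /eqP ->.
  rewrite addr0 hTheta (hA (k s)).2 mulr_sumr; apply: eq_bigr => b _.
  rewrite /V !kmk !dmk eqxx mul1r rmorphM /= rmorphM /= conjb.
  case: (eqVneq (k s) (k t)) => [->|nkst]; rewrite ?eqxx.
    by rewrite !mul1r; ring.
  by rewrite !mul0r !mulr0.
rewrite (eigen_dec_entropy hV) (sum_coords kmk dmk mkkd) /shannon -!sumrN -big_split /=.
apply: eq_bigr => z _.
transitivity (- (\sum_b (q z * log2 (q z) * lam z b + q z * (lam z b * log2 (lam z b))))).
  congr (- _); apply: eq_bigr => b _; rewrite kmk dmk.
  (* Splitting the logarithm of a product needs positive factors; a zero factor makes both sides
     vanish. *)
  have := q0 z; rewrite le_eqVlt => /orP[/eqP <-|qp]; first by rewrite !mul0r addr0.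
  have := lam0 z b; rewrite le_eqVlt => /orP[/eqP <-|lp].
    by rewrite !(mulr0, mul0r) addr0.
  by rewrite log2M //; ring.
by rewrite big_split /= -!mulr_sumr lam1; ring.
Qed.

Lemma entropy_classical (Z : finType) (q : Z -> R) (A : op R Z) :
  (forall s t, A s t = (s == t)%:R * (q s)%:C) -> entropy A = shannon q.
Proof.
move=> hA; apply: (@eigen_dec_entropy _ _ _ (@idop R Z)).
have conjb (b : bool) : conjc (b%:R : C) = b%:R by rewrite conjc_nat.
split=> s t; rewrite (bigD1 s) //= [X in _ + X]big1 => [|k ks]; rewrite /idop.
- by rewrite eqxx mul1r addr0 conjb eq_sym.
- by rewrite eq_sym (negPf ks) mul0r.
- by rewrite hA eqxx mul1r addr0 conjb mulrC eq_sym.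
- by rewrite eq_sym (negPf ks) !mul0r.
Qed.

End Entropies.

(** * Mutual informations of the code state as differences of spectral entropies *)

Section Informations.
Variables (R : realType) (X B1 B2 W : finType).
Variables (rho : X -> op R (B1 * B2)%type) (hrho : forall x, density (rho x)).
Variables (pW : W -> R) (pXW : W -> X -> R).
Hypotheses (hpW0 : forall w, 0 <= pW w) (hpW1 : \sum_w pW w = 1).
Hypotheses (hpXW0 : forall w x, 0 <= pXW w x) (hpXW1 : forall w, \sum_x pXW w x = 1).
Local Notation C := (R[i])%type.

Definition rcv1 (x : X) : op R B1 := marg fst snd (rho x).
Definition rcv2 (x : X) : op R B2 := marg snd fst (rho x).

Lemma rcv1E x s t : rcv1 x s t = \sum_v rho x (s, v) (t, v).
Proof. by rewrite /rcv1 (margE (mk := pair)) // => -[]. Qed.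

Lemma rcv2E x s t : rcv2 x s t = \sum_v rho x (v, s) (v, t).
Proof. by rewrite /rcv2 (margE (mk := fun u v => (v, u))) // => -[]. Qed.

Lemma rcv1_density x : density (rcv1 x).
Proof. by apply: (marg_density (mk := pair)) => // -[]. Qed.

Lemma rcv2_density x : density (rcv2 x).
Proof. by apply: (marg_density (mk := fun u v => (v, u))) => // -[]. Qed.

Lemma thetaE s t : theta pW pXW rho s t =
  ((s.1.1.1 == t.1.1.1) && (s.1.1.2 == t.1.1.2))%:R *
  (pW s.1.1.1 * pXW s.1.1.1 s.1.1.2)%:C * rho s.1.1.2 (s.1.2, s.2) (t.1.2, t.2).
Proof.
rewrite /theta (bigD1 s.1.1.1) //= [X in _ + X]big1 => [|w ws]; last first.
  by apply: big1 => x _; rewrite eq_sym (negPf ws) mulr0 mul0r.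
rewrite addr0 (bigD1 s.1.1.2) //= [X in _ + X]big1 => [|x xs]; last first.
  by rewrite [s.1.1.2 == x]eq_sym (negPf xs) andbF mulr0 mul0r.
rewrite addr0 !eqxx /= andbT [t.1.1.1 == _]eq_sym [t.1.1.2 == _]eq_sym.
by congr (_ * _); exact: mulrC.
Qed.

Variables (U1 : X -> op R B1) (l1 : X -> B1 -> R).
Variables (V1 : W -> op R B1) (m1 : W -> B1 -> R) (V2 : W -> op R B2) (m2 : W -> B2 -> R).
Variables (Y1 : op R B1) (n1 : B1 -> R) (Y2 : op R B2) (n2 : B2 -> R).
Hypotheses (e_l1 : forall x, eigen_dec (rcv1 x) (U1 x) (l1 x))
  (l10 : forall x b, 0 <= l1 x b).
Hypotheses (e_m1 : forall w, eigen_dec (mix (pXW w) rcv1) (V1 w) (m1 w))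
  (m10 : forall w b, 0 <= m1 w b).
Hypotheses (e_m2 : forall w, eigen_dec (mix (pXW w) rcv2) (V2 w) (m2 w))
  (m20 : forall w b, 0 <= m2 w b).
Hypotheses (e_n1 : eigen_dec (mix pW (fun w => mix (pXW w) rcv1)) Y1 n1).
Hypotheses (e_n2 : eigen_dec (mix pW (fun w => mix (pXW w) rcv2)) Y2 n2).

Let l11 x : \sum_b l1 x b = 1.
Proof. exact: eigen_dec_density_sum (rcv1_density x) (e_l1 x). Qed.
Let m11 w : \sum_b m1 w b = 1.
Proof. by apply: eigen_dec_density_sum (e_m1 w); apply: mix_density => //; exact: rcv1_density. Qed.
Let m21 w : \sum_b m2 w b = 1.
Proof. by apply: eigen_dec_density_sum (e_m2 w); apply: mix_density => //; exact: rcv2_density. Qed.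

(** This is H(B1|X), and equally H(B1|WX), because the output state depends on [x] alone. The same
    quantity therefore enters both information bounds of Receiver 1. *)
Let avg_l1 : R := \sum_w pW w * \sum_x pXW w x * shannon (l1 x).

(** The chain rule for classical-quantum states: the entropies of the classical registers XW and W
    cancel, leaving H(B1|W) - H(B1|X). *)
Lemma cond_info_receiver1 :
  qCMI (marg (fun t : W * X * B1 * B2 => (t.1.1.2, t.1.2, t.1.1.1))
             (fun t => t.2) (theta pW pXW rho)) =
  \sum_w pW w * shannon (m1 w) - avg_l1.
Proof.
set M := marg _ _ _.
have ME s t : M s t = ((s.1.1, s.2) == (t.1.1, t.2))%:R *
    (pW s.2 * pXW s.2 s.1.1)%:C * rcv1 s.1.1 s.1.2 t.1.2.
  rewrite /M (margE (mk := fun (u : X * B1 * W) (v : B2) => (u.2, u.1.1, u.1.2, v))) //;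
    [|by case=> [[]]|by case=> [[[]]]].
  rewrite rcv1E mulr_sumr; apply: eq_bigr => v _; rewrite thetaE /=.
  by rewrite xpair_eqE andbC.
rewrite /qCMI.
rewrite (@entropy_cq _ _ _ _ (fun t => (t.1.1, t.2)) (fun t => t.1.2)
   (fun z b => (z.1, b, z.2)) _ _ _ (fun z => pW z.2 * pXW z.2 z.1)
   (fun z => rcv1 z.1) (fun z => U1 z.1) (fun z => l1 z.1)) //;
  try by [case=> [] | case=> [[]]|move=> z; rewrite mulr_ge0].
rewrite (@entropy_classical _ _ (fun z => pW z.2 * pXW z.2 z.1)); last first.
  move=> s t.
  rewrite (margE (mk := fun (u : X * W) (v : B1) => (u.1, v, u.2))) //;
    [|by case=> []|by case=> [[]]].
  under eq_bigr do rewrite ME /=.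
  rewrite -mulr_sumr; have := (rcv1_density s.1).2; rewrite /trace => ->.
  by rewrite mulr1 -!surjective_pairing.
rewrite (@entropy_cq _ _ _ _ (fun t => t.2) (fun t => t.1)
   (fun z b => (b, z)) _ _ _ pW (fun w => mix (pXW w) rcv1) V1 m1) //;
   [|by case|]; last first.
  move=> s t.
  rewrite (margE (mk := fun (u : B1 * W) (v : X) => (v, u.1, u.2))) //;
    [|by case=> []|by case=> [[]]].
  rewrite /mix mulr_sumr; apply: eq_bigr => x _; rewrite ME /= xpair_eqE eqxx /=.
  by rewrite rmorphM /=; ring.
rewrite (@entropy_classical _ _ pW); last first.
  move=> s t.
  rewrite (margE (mk := fun (u : W) (v : X * B1) => (v, u))) //; [|by case].
  rewrite -(pair_bigA _ (fun x b => M (x, b, s) (x, b, t))) /=.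
  transitivity (\sum_x (s == t)%:R * (pW s * pXW s x)%:C).
    apply: eq_bigr => x _; under eq_bigr do rewrite ME /= xpair_eqE eqxx /=.
    by rewrite -mulr_sumr; have := (rcv1_density x).2; rewrite /trace => ->; rewrite mulr1.
  by rewrite -mulr_sumr -rmorph_sum -mulr_sumr hpXW1 mulr1.
have -> : \sum_z pW z.2 * pXW z.2 z.1 * shannon (l1 z.1) = avg_l1.
  rewrite -(pair_bigA _ (fun x w => pW w * pXW w x * shannon (l1 x))) exchange_big /=.
  by apply: eq_bigr => w _; rewrite mulr_sumr; apply: eq_bigr => x _; rewrite mulrA.
by move: (shannon _) (shannon _) (\sum_w _) avg_l1 => *; ring.
Qed.

Lemma info_receiver2 :
  qMI (marg (fun t : W * X * B1 * B2 => (t.1.1.1, t.2))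
            (fun t => (t.1.1.2, t.1.2)) (theta pW pXW rho)) =
  shannon n2 - \sum_w pW w * shannon (m2 w).
Proof.
set M := marg _ _ _.
have ME s t : M s t = (s.1 == t.1)%:R * (pW s.1)%:C * mix (pXW s.1) rcv2 s.2 t.2.
  rewrite /M (margE (mk := fun (u : W * B2) (v : X * B1) => (u.1, v.1, v.2, u.2))) //;
    [|by case|by move=> u []|by case=> [[[]]]].
  rewrite -(pair_bigA _ (fun x b => theta pW pXW rho (s.1, x, b, s.2) (t.1, x, b, t.2))) /=.
  rewrite /mix mulr_sumr; apply: eq_bigr => x _; rewrite rcv2E !mulr_sumr.
  by apply: eq_bigr => b _; rewrite thetaE /= eqxx andbT rmorphM /=; ring.
rewrite /qMI.
rewrite (@entropy_cq _ _ _ _ fst snd pair _ _ _ pW (fun w => mix (pXW w) rcv2) V2 m2 M) //;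
  [|by case].
rewrite (@entropy_classical _ _ pW); last first.
  move=> s t; rewrite (margE (mk := pair)) //; [|by case].
  under eq_bigr do rewrite ME /=.
  have hd : density (mix (pXW s) rcv2) by apply: mix_density => //; exact: rcv2_density.
  by rewrite -mulr_sumr; have := hd.2; rewrite /trace => ->; rewrite mulr1.
have -> : marg snd fst M = mix pW (fun w => mix (pXW w) rcv2).
  apply/funext => s; apply/funext => t.
  rewrite (margE (mk := fun u v => (v, u))) //; [|by case].
  by rewrite /mix; apply: eq_bigr => w _; rewrite ME eqxx mul1r.
rewrite (eigen_dec_entropy e_n2) -/(shannon n2).
by move: (shannon _) (shannon _) (\sum_w _) => *; ring.
Qed.

(** The marginal law of X is unfolded back into [pW] and [pXW], so that this bound is expressed
    through the same [avg_l1] and through the average state used by [Q]. *)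
Lemma info_receiver1 :
  qMI (marg (fun t : W * X * B1 * B2 => (t.1.1.2, t.1.2))
            (fun t => (t.1.1.1, t.2)) (theta pW pXW rho)) =
  shannon n1 - avg_l1.
Proof.
set M := marg _ _ _.
pose pX x := \sum_w pW w * pXW w x.
have ME s t : M s t = (s.1 == t.1)%:R * (pX s.1)%:C * rcv1 s.1 s.2 t.2.
  rewrite /M (margE (mk := fun (u : X * B1) (v : W * B2) => (v.1, u.1, u.2, v.2))) //;
    [|by case|by move=> u []|by case=> [[[]]]].
  rewrite -(pair_bigA _ (fun w b => theta pW pXW rho (w, s.1, s.2, b) (w, t.1, t.2, b))) /=.
  transitivity (\sum_w (s.1 == t.1)%:R * (pW w * pXW w s.1)%:C * rcv1 s.1 s.2 t.2);
    last by rewrite -mulr_suml -mulr_sumr -rmorph_sum.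
  apply: eq_bigr => w _; rewrite rcv1E mulr_sumr.
  by apply: eq_bigr => b _; rewrite thetaE /= eqxx.
rewrite /qMI.
rewrite (@entropy_cq _ _ _ _ fst snd pair _ _ _ pX rcv1 U1 l1 M) //;
  [|by case|by move=> x; apply: sumr_ge0 => w _; rewrite mulr_ge0].
rewrite (@entropy_classical _ _ pX); last first.
  move=> s t; rewrite (margE (mk := pair)) //; [|by case].
  under eq_bigr do rewrite ME /=.
  by rewrite -mulr_sumr; have := (rcv1_density s).2; rewrite /trace => ->; rewrite mulr1.
have -> : marg snd fst M = mix pW (fun w => mix (pXW w) rcv1).
  apply/funext => s; apply/funext => t.
  rewrite (margE (mk := fun u v => (v, u))) //; [|by case].
  transitivity (\sum_x \sum_w (pW w * pXW w x)%:C * rcv1 x s t).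
    apply: eq_bigr => x _; rewrite ME eqxx mul1r -mulr_suml.
    by rewrite -rmorph_sum.
  rewrite exchange_big; apply: eq_bigr => w _; rewrite /mix mulr_sumr.
  by apply: eq_bigr => x _; rewrite rmorphM mulrA.
rewrite (eigen_dec_entropy e_n1) -/(shannon n1).
have -> : \sum_x pX x * shannon (l1 x) = avg_l1.
  under eq_bigr do rewrite mulr_suml.
  rewrite exchange_big; apply: eq_bigr => w _; rewrite mulr_sumr.
  by apply: eq_bigr => x _; rewrite mulrA.
by move: (shannon _) (shannon _) avg_l1 => *; ring.
Qed.

End Informations.

(** * One-shot coding *)

Section OneShot.
Variable R : realType.
Local Notation C := (R[i])%type.

Lemma sqn_sum_state (d : nat) (Z : finType) (q : Z -> R) (rho : Z -> 'M[C]_d) M :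
  sqn (\sum_z (q z)%:C *: rho z) M = \sum_z q z * sqn (rho z) M.
Proof.
rewrite /sqn mulmx_sumr mulmx_suml rtr_sum; apply: eq_bigr => z _.
by rewrite -scalemxAr -scalemxAl rtrZ.
Qed.

Lemma sqn_le_state (d : nat) (rho sig M : 'M[C]_d) :
  psdmx (sig - rho) -> sqn rho M <= sqn sig M.
Proof.
move=> /(psdmx_conj M)/psdmx_rtr_ge0.
by rewrite mulmxBr mulmxBl rtrB subr_ge0.
Qed.

Lemma sqn_scalar (d : nat) (a : R) (M : 'M[C]_d) :
  sqn a%:C%:M M = a * rtr (M *m adjmx M).
Proof. by rewrite /sqn mul_mx_scalar -scalemxAl rtrZ. Qed.

Lemma sqn_mulr (d : nat) (rho M N : 'M[C]_d) :
  sqn rho (M *m N) = sqn (N *m rho *m adjmx N) M.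
Proof. by rewrite /sqn adjmxM !mulmxA. Qed.

(** By cyclicity this is the contraction property of [Q] in the seminorm of the identity state. *)
Lemma rtr_proj_mul_le (d : nat) (P Q : 'M[C]_d) : projmx P -> projmx Q ->
  rtr (P *m Q *m adjmx (P *m Q)) <= rtr P.
Proof.
move=> [aP PP] hQ; have [aQ QQ] := hQ.
have := sqn_proj (@psdmx1 R d) P hQ.
rewrite /sqn !mulmx1 !adjmxM aP aQ PP mulmxA -(mulmxA Q) PP.
rewrite rtr_mulC (mulmxA Q Q) QQ rtr_mulC -(mulmxA P) (mulmxA Q Q) QQ.
by rewrite mulmxA (rtr_mulC (P *m Q)) mulmxA PP.
Qed.

(** Replacing the state by a multiple of the identity turns a false-acceptance probability into a
    trace, bounded by the rank of the test. *)
Lemma sqn_wrong_le (d : nat) (rho P Q : 'M[C]_d) (a b : R) :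
  0 <= a -> projmx P -> projmx Q -> psdmx (a%:C%:M - rho) -> rtr P <= b ->
  sqn rho (P *m Q) <= a * b.
Proof.
move=> a0 hP hQ ha hb; apply: le_trans (sqn_le_state _ ha) _.
rewrite sqn_scalar ler_wpM2l //; exact: le_trans (rtr_proj_mul_le hP hQ) hb.
Qed.

Lemma sqn_wrong_proj_le (d : nat) (rho P Q : 'M[C]_d) (a b : R) :
  0 <= a -> projmx P -> projmx Q -> psdmx (a%:C%:M - Q *m rho *m Q) ->
  rtr P <= b -> sqn rho (P *m Q) <= a * b.
Proof.
move=> a0 hP hQ ha hb; rewrite sqn_mulr hQ.1 -[P]mulmx1.
exact: sqn_wrong_le (projmx1 _ _) ha hb.
Qed.

Lemma sqn0 (d : nat) (rho : 'M[C]_d) : sqn rho 0 = 0.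
Proof. by rewrite /sqn mul0mx mul0mx rtr0. Qed.

Lemma le_of_eq (x y : R) : x = y -> x <= y.
Proof. by move->. Qed.

Lemma sum_pair_neq (I J : finType) (F : I -> J -> R) (i : I) (j : J) :
  \sum_(p | p != (i, j)) F p.1 p.2 =
  \sum_(i' | i' != i) F i' j + \sum_(j' | j' != j) \sum_i' F i' j'.
Proof.
apply: (@addrI _ (F i j)).
transitivity (\sum_p F p.1 p.2); first by rewrite [RHS](bigD1 (i, j)).
by rewrite -(pair_bigA _ F) exchange_big (bigD1 j) //= (bigD1 i) //= addrA.
Qed.

Variables (TW TX I1 I2 : finType) (d1 d2 : nat).
Variables (pw : TW -> R) (px : TW -> TX -> R).
Hypotheses (pw0 : forall w, 0 <= pw w) (pw1 : \sum_w pw w = 1).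
Hypotheses (px0 : forall w x, 0 <= px w x) (px1 : forall w, \sum_x px w x = 1).
Variables (rho1 : TX -> 'M[C]_d1) (rho2 : TX -> 'M[C]_d2).
Hypotheses (psd1 : forall x, psdmx (rho1 x)) (tr1 : forall x, rtr (rho1 x) = 1).
Hypotheses (psd2 : forall x, psdmx (rho2 x)) (tr2 : forall x, rtr (rho2 x) = 1).
Let sig1 w := \sum_x (px w x)%:C *: rho1 x.
Let sig2 w := \sum_x (px w x)%:C *: rho2 x.
Let tau1 := \sum_w (pw w)%:C *: sig1 w.
Let tau2 := \sum_w (pw w)%:C *: sig2 w.
Variables (P : TX -> 'M[C]_d1) (G : TW -> 'M[C]_d1) (Q : 'M[C]_d1).
Variables (P2 : TW -> 'M[C]_d2) (Q2 : 'M[C]_d2).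
Hypotheses (projP : forall x, projmx (P x)) (projG : forall w, projmx (G w))
  (projQ : projmx Q) (projP2 : forall w, projmx (P2 w)) (projQ2 : projmx Q2).
Variables (e alpha beta gamma beta2 gamma2 : R).
Hypotheses (alpha0 : 0 <= alpha) (gamma0 : 0 <= gamma) (gamma20 : 0 <= gamma2).
Hypothesis eP : \sum_w pw w * \sum_x px w x * sqn (rho1 x) (1%:M - P x) <= e.
Hypothesis eG : \sum_w pw w * sqn (sig1 w) (1%:M - G w) <= e.
Hypothesis eQ : sqn tau1 (1%:M - Q) <= e.
Hypothesis eP2 : \sum_w pw w * sqn (sig2 w) (1%:M - P2 w) <= e.
Hypothesis eQ2 : sqn tau2 (1%:M - Q2) <= e.
Hypothesis trP : forall x, rtr (P x) <= beta.
Hypothesis leG : forall w, psdmx (alpha%:C%:M - G w *m sig1 w *m G w).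
Hypothesis leGsig : forall w, psdmx (sig1 w - G w *m sig1 w *m G w).
Hypothesis leQ : psdmx (gamma%:C%:M - Q *m tau1 *m Q).
Hypothesis trP2 : forall w, rtr (P2 w) <= beta2.
Hypothesis leQ2 : psdmx (gamma2%:C%:M - Q2 *m tau2 *m Q2).

(* The state sent for [(w, x)] is replaced in the analysis by [G w *m rho1 x *m G w].
   Averaged over [x] it is at most [alpha], which controls the wrong codewords of the
   same cloud; averaged also over [w] it is at most [tau1], because
   [G w *m sig1 w *m G w <= sig1 w], and [Q] controls those of the other clouds. *)
Lemma one_shot_code (i10 : I1) (i20 : I2) (t : R) : 0 < t ->
  exists (g : I1 -> I2 -> TX) (L1 : I1 * I2 -> 'M[C]_d1) (L2 : I2 -> 'M[C]_d2),
  [/\ (forall i, psdmx (L1 i)) /\ \sum_i L1 i = 1%:M,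
      (forall i, psdmx (L2 i)) /\ \sum_i L2 i = 1%:M &
  \sum_i2 \sum_i1 ((1 - rtr (L1 (i1, i2) *m rho1 (g i1 i2)))
                 + (1 - rtr (L2 i2 *m rho2 (g i1 i2)))) <=
  (#|I2|%:R * #|I1|%:R) * (2 * t + t^-1 * (130 * e + 4 *
      ((#|I1|.-1)%:R * (alpha * beta)
       + (#|I2|.-1)%:R * (#|I1|%:R * (gamma * beta))
       + (#|I2|.-1)%:R * (gamma2 * beta2))))].
Proof.
move=> t0.
pose a1 w x := 26 * (sqn (rho1 x) (1%:M - G w) + sqn (rho1 x) (1%:M - Q)
                     + sqn (rho1 x) (1%:M - P x)).
pose a2 w x := 26 * (sqn (rho2 x) (1%:M - Q2) + sqn (rho2 x) (1%:M - P2 w)).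
pose a w x := a1 w x + a2 w x.
pose b w x y := 4 * sqn (rho1 x) (P y *m Q *m G w).
pose b' (w : TW) x v := 4 * sqn (rho2 x) (P2 v *m Q2).
have sig1E w M : \sum_x px w x * sqn (rho1 x) M = sqn (sig1 w) M.
  by rewrite sqn_sum_state.
have sig2E w M : \sum_x px w x * sqn (rho2 x) M = sqn (sig2 w) M.
  by rewrite sqn_sum_state.
have tau1E M : \sum_w pw w * sqn (sig1 w) M = sqn tau1 M.
  by rewrite sqn_sum_state.
have tau2E M : \sum_w pw w * sqn (sig2 w) M = sqn tau2 M.
  by rewrite sqn_sum_state.
have lin (F : TX -> R) (c : R) w :
    \sum_x px w x * (c * F x) = c * \sum_x px w x * F x.
  by rewrite mulr_sumr; apply: eq_bigr => x _; rewrite mulrCA.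
have linw (F : TW -> R) (c : R) : \sum_w pw w * (c * F w) = c * \sum_w pw w * F w.
  by rewrite mulr_sumr; apply: eq_bigr => x _; rewrite mulrCA.
(* Five failure probabilities, three at Receiver 1 and two at Receiver 2, each at most [e] and
   weighted by 26: hence 130. *)
have ha : \sum_w pw w * \sum_x px w x * a w x <= 130 * e.
  have -> : \sum_w pw w * \sum_x px w x * a w x = 26 * (
     \sum_w pw w * sqn (sig1 w) (1%:M - G w) + sqn tau1 (1%:M - Q)
     + \sum_w pw w * \sum_x px w x * sqn (rho1 x) (1%:M - P x))
     + 26 * (sqn tau2 (1%:M - Q2) + \sum_w pw w * sqn (sig2 w) (1%:M - P2 w)).
    rewrite -tau1E -tau2E -!big_split /= !mulr_sumr -big_split /=.
    apply: eq_bigr => w _; rewrite -!sig1E -!sig2E.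
    transitivity (pw w * \sum_x (26 * (px w x * sqn (rho1 x) (1%:M - G w)
       + px w x * sqn (rho1 x) (1%:M - Q) + px w x * sqn (rho1 x) (1%:M - P x))
       + 26 * (px w x * sqn (rho2 x) (1%:M - Q2) + px w x * sqn (rho2 x) (1%:M - P2 w)))).
      congr (_ * _); apply: eq_bigr => x _; rewrite /a /a1 /a2.
      by move: (sqn _ _) (sqn _ _) (sqn _ _) (sqn _ _) (sqn _ _) => *; ring.
    rewrite big_split /= -!mulr_sumr !big_split /=.
    by move: (\sum_x _) (\sum_x _) (\sum_x _) (\sum_x _) (\sum_x _) => *; ring.
  move: eP eG eQ eP2 eQ2.
  by move: (\sum_w _) (\sum_w _) (sqn _ _) (\sum_w _) (sqn _ _) => x1 x2 x3 x4 x5; lra.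
have hb w y : \sum_x px w x * b w x y <= 4 * (alpha * beta).
  rewrite lin sig1E ler_pM2l // sqn_mulr (projG w).1.
  exact: sqn_wrong_le.
have hb2 y : \sum_w pw w * \sum_x px w x * b w x y <= 4 * (gamma * beta).
  under eq_bigr do rewrite lin sig1E.
  rewrite linw ler_pM2l //.
  apply: (@le_trans _ _ (\sum_w pw w * sqn (sig1 w) (P y *m Q))).
    apply: ler_sum => w _; rewrite ler_wpM2l // sqn_mulr (projG w).1.
    exact: sqn_le_state.
  rewrite tau1E; exact: sqn_wrong_proj_le.
have hb3 v : \sum_w pw w * \sum_x px w x * b' w x v <= 4 * (gamma2 * beta2).
  under eq_bigr do rewrite lin sig2E.
  rewrite linw ler_pM2l // tau2E; exact: sqn_wrong_proj_le.
have [f [g hfg]] := @random_superposition_code R TW TX I1 I2 pw px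
   pw0 pw1 px0 px1 a b b' _ _ _ _ ha hb hb2 hb3.
have [L1 [psdL1 sumL1 errL1]] := @sequential_decoder R d1 (I1 * I2)%type (i10, i20) Q
  (fun i => P (g i.1 i.2)) projQ (fun i => projP _).
have [L2 [psdL2 sumL2 errL2]] := @sequential_decoder R d2 I2 i20 Q2
  (fun i => P2 (f i)) projQ2 (fun i => projP2 _).
exists g, L1, L2; split => //.
pose c i2 i1 := a (f i2) (g i1 i2) +
    \sum_(j1 | j1 != i1) b (f i2) (g i1 i2) (g j1 i2) +
    \sum_(j2 | j2 != i2) \sum_j1 b (f i2) (g i1 i2) (g j1 j2) +
    \sum_(j2 | j2 != i2) b' (f i2) (g i1 i2) (f j2).
apply: (@le_trans _ _ (\sum_i2 \sum_i1 (2 * t + t^-1 * c i2 i1))).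
  apply: ler_sum => i2 _; apply: ler_sum => i1 _.
  have h1 := errL1 (i1, i2) (rho1 (g i1 i2)) (G (f i2)) t (psd1 _) (projG _) t0.
  (* Receiver 2 has only competitors from other clouds, for which [Q2] suffices, so its smoothing
     projection is the identity. *)
  have h2 := errL2 i2 (rho2 (g i1 i2)) 1%:M t (psd2 _) (projmx1 _ _) t0.
  rewrite tr1 mulr1 in h1; rewrite tr2 mulr1 in h2.
  apply: le_trans (lerD h1 h2) _.
  rewrite addrACA -mulrDr /= subrr sqn0 add0r.
  rewrite (eq_bigr (fun j2 => sqn (rho2 (g i1 i2)) (P2 (f j2) *m Q2)));
    last by move=> j2 _; rewrite mulmx1.
  rewrite (sum_pair_neq (fun j1 j2 =>
    sqn (rho1 (g i1 i2)) (P (g j1 j2) *m Q *m G (f i2)))).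
  have -> : t + t = 2 * t by ring.
  rewrite lerD2l ler_pM2l ?invr_gt0 //; apply: le_of_eq.
  have cE : c i2 i1 = a1 (f i2) (g i1 i2) + a2 (f i2) (g i1 i2)
      + 4 * (\sum_(j1 | j1 != i1) sqn (rho1 (g i1 i2)) (P (g j1 i2) *m Q *m G (f i2)))
      + 4 * (\sum_(j2 | j2 != i2) \sum_j1
               sqn (rho1 (g i1 i2)) (P (g j1 j2) *m Q *m G (f i2)))
      + 4 * (\sum_(j2 | j2 != i2) sqn (rho2 (g i1 i2)) (P2 (f j2) *m Q2)).
    rewrite [in RHS]mulr_sumr [in RHS]mulr_sumr [in RHS]mulr_sumr /c.
    by congr (_ + _ + _ + _); apply: eq_bigr => j2 _; rewrite mulr_sumr.
  rewrite cE -/(a1 (f i2) (g i1 i2)) -/(a2 (f i2) (g i1 i2)).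
  move: (a1 _ _) (a2 _ _) (\sum_(j | _) _) (\sum_(j | _) _) (\sum_(j | _) _) => *.
  by ring.
apply: (@le_trans _ _ ((#|I2|%:R * #|I1|%:R) * (2 * t)
   + t^-1 * \sum_i2 \sum_i1 c i2 i1)).
  apply: le_of_eq; under eq_bigr do rewrite big_split /= sumr_const -mulr_sumr.
  rewrite big_split /= sumr_const -mulr_sumr -mulrnA; congr (_ + _).
  by rewrite -[LHS]mulr_natl natrM; congr (_ * _); exact: mulrC.
rewrite [leRHS]mulrDr lerD2l.
rewrite [leRHS]mulrCA ler_pM2l ?invr_gt0 //; apply: le_trans hfg _.
apply: le_of_eq; congr (_ * _); ring.
Qed.

End OneShot.

(** * Typical projections and i.i.d. codes *)

Section Typicality.
Variable R : realType.
Local Notation C := (R[i])%type.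

(** Entropy in nats, matching the [expR] thresholds; the factor [ln 2] reappears only when rates are
    compared. *)
Definition shannon_nats (T : finType) (q : T -> R) : R := - \sum_t q t * ln (q t).

Lemma shannon_natsE (T : finType) (q : T -> R) : shannon_nats q = ln 2 * shannon q.
Proof.
have l2 : ln 2 != 0 :> R by rewrite gt_eqF // ln_gt0 // ltr1n.
rewrite /shannon_nats /shannon mulrN mulr_sumr; congr (- _); apply: eq_bigr => t _.
by rewrite /log2 mulrCA [ln 2 * _]mulrC divfK.
Qed.

Lemma prod_expR_ln (I : finType) (f : I -> R) : (forall i, 0 < f i) ->
  \prod_i f i = expR (\sum_i ln (f i)).
Proof.
by move=> f0; rewrite expR_sum; apply: eq_bigr => i _; rewrite lnK ?posrE.
Qed.

Lemma prod_gt0_inv (I : finType) (f : I -> R) : (forall i, 0 <= f i) ->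
  0 < \prod_i f i -> forall i, 0 < f i.
Proof.
move=> f0 hf i; rewrite lt_neqAle f0 andbT; apply: contraTneq hf => fi.
by rewrite (bigD1 i) //= -fi mul0r ltxx.
Qed.

Section Ensemble.
Variables (Z B : finType) (p : Z -> R) (d : Z -> B -> R).
Hypotheses (p0 : forall z, 0 <= p z) (p1 : \sum_z p z = 1).
Hypotheses (d0 : forall z b, 0 <= d z b) (d1 : forall z, \sum_b d z b = 1).
Let S : R := \sum_z p z * shannon_nats (d z).

Let P0 z b : 0 <= p z * d z b. Proof. exact: mulr_ge0. Qed.

Let P1 : \sum_z \sum_b p z * d z b = 1.
Proof. by rewrite -p1; apply: eq_bigr => z _; rewrite -mulr_sumr d1 mulr1. Qed.

Let Sln : \sum_z \sum_b (p z * d z b) * ln (d z b) = - S.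
Proof.
rewrite /S -sumrN; apply: eq_bigr => z _.
rewrite /shannon_nats mulrN opprK mulr_sumr; apply: eq_bigr => b _.
by rewrite mulrA.
Qed.

Let mean_affine (a c : R) :
  \sum_z \sum_b (p z * d z b) * (a * ln (d z b) + c) = - (a * S) + c.
Proof.
transitivity (a * (\sum_z \sum_b (p z * d z b) * ln (d z b))
              + c * (\sum_z \sum_b p z * d z b)).
  rewrite !mulr_sumr -big_split /=; apply: eq_bigr => z _.
  rewrite !mulr_sumr -big_split /=; apply: eq_bigr => b _; ring.
by rewrite Sln P1 mulr1 mulrN.
Qed.

(** The Chernoff bound for an affine function of the log-probability with negative mean. Sequences
    of probability zero contribute nothing, so the deviation [hD] is asked only where all logarithms
    are meaningful. *)
Let eventually_small (a c eps : R) (D : forall n, {ffun 'I_n -> Z} -> pred {ffun 'I_n -> B}) :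
  0 < eps -> - (a * S) + c < 0 ->
  (forall n z k, D n z k -> 0 < \prod_i d (z i) (k i) ->
     0 <= \sum_i (a * ln (d (z i) (k i)) + c)) ->
  exists N, forall n, (N <= n)%N ->
    \sum_(z : {ffun 'I_n -> Z}) (\prod_i p (z i)) *
      \sum_(k | D n z k) \prod_i d (z i) (k i) <= eps.
Proof.
move=> e0 hneg hD.
have [q q01 hq] := @chernoff_bound R Z B (fun z b => p z * d z b)
  (fun z b => a * ln (d z b) + c) P0 P1 ltac:(by rewrite mean_affine).
have [N hN] := expr_eventually_le q01 e0.
exists N => n Nn; apply: le_trans (hN n Nn); apply: le_trans (hq n).
apply: ler_sum => z _; rewrite mulr_sumr [leLHS]big_mkcond [leRHS]big_mkcond.
apply: ler_sum => k _; rewrite -big_split /=.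
have h0 : 0 <= \prod_i (p (z i) * d (z i) (k i)) by apply: prodr_ge0.
case: ifP => [hDk|_]; last by case: ifP.
case: ifP => [|/negbT hk]; first by rewrite lexx.
rewrite big_split /=.
have : 0 <= \prod_i d (z i) (k i) by apply: prodr_ge0.
rewrite le_eqVlt => /orP[/eqP <-|dp]; first by rewrite mulr0.
by rewrite hD in hk.
Qed.

(** The excluded sequences are too probable. Capping the eigenvalues from above is what compressing
    an averaged state requires. *)
Lemma typical_low (delta eps : R) : 0 < delta -> 0 < eps ->
  exists N, forall n, (N <= n)%N ->
    \sum_(z : {ffun 'I_n -> Z}) (\prod_i p (z i)) *
      \sum_(k : {ffun 'I_n -> B} |
              ~~ (\prod_i d (z i) (k i) <= expR (- (n%:R * (S - delta)))))
        \prod_i d (z i) (k i) <= eps.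
Proof.
move=> dl0 e0.
apply: (@eventually_small 1 (S - delta) eps (fun n z k =>
  ~~ (\prod_i d (z i) (k i) <= expR (- (n%:R * (S - delta)))))) => //.
  by lra.
move=> n z k hk hp; rewrite -ltNge in hk.
have dp := prod_gt0_inv (fun i => d0 (z i) (k i)) hp.
move: hk; rewrite (prod_expR_ln dp) ltr_expR big_split /= sumr_const card_ord.
under [X in _ <= X + _]eq_bigr do rewrite mul1r.
by rewrite -mulr_natl; lra.
Qed.

(** The excluded sequences are too improbable. The lower bound on those kept limits their number,
    hence the rank of a codeword test. *)
Lemma typical_high (delta eps : R) : 0 < delta -> 0 < eps ->
  exists N, forall n, (N <= n)%N ->
    \sum_(z : {ffun 'I_n -> Z}) (\prod_i p (z i)) *
      \sum_(k : {ffun 'I_n -> B} |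
              ~~ (expR (- (n%:R * (S + delta))) <= \prod_i d (z i) (k i)))
        \prod_i d (z i) (k i) <= eps.
Proof.
move=> dl0 e0.
apply: (@eventually_small (-1) (- S - delta) eps (fun n z k =>
  ~~ (expR (- (n%:R * (S + delta))) <= \prod_i d (z i) (k i)))) => //.
  by lra.
move=> n z k hk hp; rewrite -ltNge in hk.
have dp := prod_gt0_inv (fun i => d0 (z i) (k i)) hp.
move: hk; rewrite (prod_expR_ln dp) ltr_expR big_split /= sumr_const card_ord.
rewrite -mulr_sumr -mulr_natl; lra.
Qed.

(** Each counted sequence has probability at least exp(-a), and the total is 1. *)
Lemma typical_card (n : nat) (z : 'I_n -> Z) (a : R) :
  \sum_(k : {ffun 'I_n -> B}) (expR (- a) <= \prod_i d (z i) (k i))%R%:R <= expR a.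
Proof.
have h1 : \sum_(k : {ffun 'I_n -> B}) \prod_i d (z i) (k i) = 1.
  by rewrite (sum_ffun_prod1 (q := fun i => d (z i))).
apply: (@le_trans _ _ (\sum_(k : {ffun 'I_n -> B}) expR a * \prod_i d (z i) (k i))).
  apply: ler_sum => k _.
  have h0 : 0 <= \prod_i d (z i) (k i) by apply: prodr_ge0.
  have [hk|hk] := lerP (expR (- a)) (\prod_i d (z i) (k i)).
    by rewrite -ler_pdivrMl ?expR_gt0 // mulr1 -expRN.
  by rewrite mulr_ge0 ?expR_ge0.
by rewrite -mulr_sumr h1 mulr1.
Qed.

End Ensemble.

Section SpectralProjections.
Variables (T : finType) (A U : op R T) (d : T -> R).
Hypotheses (hA : eigen_dec A U d) (d0 : forall k, 0 <= d k).
Variable S : pred T.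
Let P := spmx U (fun k => (S k)%:R).

Lemma sqn_spectral_compl : sqn (opmx A) (1%:M - P) = \sum_(k | ~~ S k) d k.
Proof.
have u := hA.1; rewrite /sqn (projmxC (projmx_spmx u S)).1 (eigen_dec_spmx hA).
have -> : 1%:M - P = spmx U (fun k => 1 - (S k)%:R).
  by rewrite -spmxB (spmx_const u).
rewrite !spmxM // rtr_spmx // [RHS]big_mkcond; apply: eq_bigr => k _.
by case: (S k) => /=; rewrite ?subrr ?subr0 ?mul0r ?mul1r ?mulr1.
Qed.

Lemma spectral_compress_le (a : R) : 0 <= a -> (forall k, S k -> d k <= a) ->
  psdmx (a%:C%:M - P *m opmx A *m P).
Proof.
move=> a0 ha; have u := hA.1; rewrite (eigen_dec_spmx hA) -(spmx_const u).
rewrite /P !spmxM // spmxB; apply: psdmx_spmx => // k.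
case: (boolP (S k)) => [/ha|_]; rewrite ?mul1r ?mulr1 ?subr_ge0 //.
by rewrite mul0r mul0r.
Qed.

Lemma spectral_compress_le_self : psdmx (opmx A - P *m opmx A *m P).
Proof.
have u := hA.1; rewrite (eigen_dec_spmx hA) /P !spmxM // spmxB.
apply: psdmx_spmx => // k.
by case: (S k); rewrite ?mul1r ?mulr1 ?subrr // mul0r mul0r subr0.
Qed.

End SpectralProjections.

(** Distributivity: averaging independent letters position by position commutes with the tensor
    product. The weights may vary with the position because satellites are drawn conditionally on
    w^n. *)
Lemma tensor_power_mix (Z T : finType) (n : nat) (q : 'I_n -> Z -> R) (A : Z -> op R T) :
  \sum_(x : {ffun 'I_n -> Z}) (\prod_i q i (x i))%:C *: opmx (tensor_power A x) =
  opmx (fun s t : {ffun 'I_n -> T} => \prod_i mix (q i) A (s i) (t i)).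
Proof.
apply/matrixP => i j; rewrite summxE !mxE /mix bigA_distr_bigA /=.
apply: eq_bigr => x _; rewrite !mxE rmorph_prod /tensor_power -big_split /=.
exact: eq_bigr.
Qed.

End Typicality.

(** * Codes for product states from typical projections *)

Section IidCode.
Variables (R : realType) (X B1 B2 W : finType).
Variables (r1 : X -> op R B1) (r2 : X -> op R B2).
Variables (pW : W -> R) (pXW : W -> X -> R).
Hypotheses (hpW0 : forall w, 0 <= pW w) (hpW1 : \sum_w pW w = 1).
Hypotheses (hpXW0 : forall w x, 0 <= pXW w x) (hpXW1 : forall w, \sum_x pXW w x = 1).
Hypotheses (dens1 : forall x, density (r1 x)) (dens2 : forall x, density (r2 x)).
Local Notation C := (R[i])%type.
Let s1 w := mix (pXW w) r1.
Let s2 w := mix (pXW w) r2.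
Let t1 := mix pW s1.
Let t2 := mix pW s2.
Variables (U1 : X -> op R B1) (l1 : X -> B1 -> R).
Variables (V1 : W -> op R B1) (m1 : W -> B1 -> R) (V2 : W -> op R B2) (m2 : W -> B2 -> R).
Variables (Y1 : op R B1) (n1 : B1 -> R) (Y2 : op R B2) (n2 : B2 -> R).
Hypotheses (e_l1 : forall x, eigen_dec (r1 x) (U1 x) (l1 x))
  (l10 : forall x b, 0 <= l1 x b).
Hypotheses (e_m1 : forall w, eigen_dec (s1 w) (V1 w) (m1 w))
  (m10 : forall w b, 0 <= m1 w b).
Hypotheses (e_m2 : forall w, eigen_dec (s2 w) (V2 w) (m2 w))
  (m20 : forall w b, 0 <= m2 w b).
Hypotheses (e_n1 : eigen_dec t1 Y1 n1) (n10 : forall b, 0 <= n1 b).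
Hypotheses (e_n2 : eigen_dec t2 Y2 n2) (n20 : forall b, 0 <= n2 b).

Let Hx : R := \sum_w pW w * \sum_x pXW w x * shannon_nats (l1 x).
Let Hw1 : R := \sum_w pW w * shannon_nats (m1 w).
Let Hw2 : R := \sum_w pW w * shannon_nats (m2 w).

Lemma tensor_power_rtr (Z T : finType) (n : nat) (A U : Z -> op R T) d (z : 'I_n -> Z) :
  (forall z, eigen_dec (A z) (U z) (d z)) -> (forall z, \sum_b d z b = 1) ->
  rtr (opmx (tensor_power A z)) = 1.
Proof.
move=> h d1; have h' := tensor_power_eigen_dec z h.
rewrite (eigen_dec_spmx h') (rtr_spmx h'.1).
by rewrite (sum_ffun_prod1 (q := fun i => d (z i))).
Qed.

Let l11 x : \sum_b l1 x b = 1.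
Proof. exact: eigen_dec_density_sum (dens1 x) (e_l1 x). Qed.
Let s1_density w : density (s1 w). Proof. exact: mix_density. Qed.
Let s2_density w : density (s2 w). Proof. exact: mix_density. Qed.
Let m11 w : \sum_b m1 w b = 1.
Proof. exact: eigen_dec_density_sum (s1_density w) (e_m1 w). Qed.
Let m21 w : \sum_b m2 w b = 1.
Proof. exact: eigen_dec_density_sum (s2_density w) (e_m2 w). Qed.
Let n11 : \sum_b n1 b = 1.
Proof. by apply: (eigen_dec_density_sum _ e_n1); exact: mix_density. Qed.
Let n21 : \sum_b n2 b = 1.
Proof. by apply: (eigen_dec_density_sum _ e_n2); exact: mix_density. Qed.

(** [N] precedes the message sets because these grow with [n]: the typicality errors are independent
    of their size. *)
Lemma iid_code (delta e : R) : 0 < delta -> 0 < e ->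
  exists N, forall n, (N <= n)%N -> forall (I1 I2 : finType) (i1 : I1) (i2 : I2) (t : R),
  0 < t ->
  exists (g : I1 -> I2 -> {ffun 'I_n -> X})
    (L1 : I1 * I2 -> 'M[C]_#|{: {ffun 'I_n -> B1}}|)
    (L2 : I2 -> 'M[C]_#|{: {ffun 'I_n -> B2}}|),
  [/\ (forall i, psdmx (L1 i)) /\ \sum_i L1 i = 1%:M,
      (forall i, psdmx (L2 i)) /\ \sum_i L2 i = 1%:M &
  \sum_i2 \sum_i1 ((1 - rtr (L1 (i1, i2) *m opmx (tensor_power r1 (g i1 i2))))
                 + (1 - rtr (L2 i2 *m opmx (tensor_power r2 (g i1 i2))))) <=
  (#|I2|%:R * #|I1|%:R) * (2 * t + t^-1 * (130 * e + 4 *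
      ((#|I1|.-1)%:R * (expR (- (n%:R * (Hw1 - delta))) * expR (n%:R * (Hx + delta)))
       + (#|I2|.-1)%:R * (#|I1|%:R *
           (expR (- (n%:R * (shannon_nats n1 - delta))) * expR (n%:R * (Hx + delta))))
       + (#|I2|.-1)%:R *
           (expR (- (n%:R * (shannon_nats n2 - delta))) * expR (n%:R * (Hw2 + delta))))))].
Proof.
move=> dl0 e0.
pose pX x := \sum_w pW w * pXW w x.
have pX0 x : 0 <= pX x by apply: sumr_ge0 => w _; rewrite mulr_ge0.
have pX1 : \sum_x pX x = 1.
  rewrite exchange_big -[RHS]hpW1; apply: eq_bigr => w _.
  by rewrite -mulr_sumr hpXW1 mulr1.
have HxE : \sum_x pX x * shannon_nats (l1 x) = Hx.
  under eq_bigr do rewrite mulr_suml.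
  rewrite exchange_big; apply: eq_bigr => w _; rewrite mulr_sumr.
  by apply: eq_bigr => x _; rewrite mulrA.
have u1 : \sum_(z : unit) (1 : R) = 1 by rewrite sumr_const card_unit.
have unitH (T : finType) (q : T -> R) : \sum_(z : unit) 1 * shannon_nats q = shannon_nats q.
  by rewrite sumr_const card_unit mul1r.
have [N1 hN1] := typical_high pX0 pX1 l10 l11 dl0 e0.
have [N2 hN2] := typical_low hpW0 hpW1 m10 m11 dl0 e0.
have [N3 hN3] := typical_high hpW0 hpW1 m20 m21 dl0 e0.
have [N4 hN4] := @typical_low R unit B1 (fun=> 1) (fun=> n1)
   (fun=> ler01) u1 (fun=> n10) (fun=> n11) _ _ dl0 e0.
have [N5 hN5] := @typical_low R unit B2 (fun=> 1) (fun=> n2)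
   (fun=> ler01) u1 (fun=> n20) (fun=> n21) _ _ dl0 e0.
exists (maxn N1 (maxn N2 (maxn N3 (maxn N4 N5)))) => n.
rewrite !geq_max => /and5P[/hN1 {}hN1 /hN2 {}hN2 /hN3 {}hN3 /hN4 {}hN4 /hN5 {}hN5].
move=> I1 I2 i1 i2 t tpos.
rewrite HxE in hN1; rewrite unitH in hN4; rewrite unitH in hN5.
set thx := expR (- (n%:R * (Hx + delta))) in hN1.
set thw1 := expR (- (n%:R * (_ - delta))) in hN2.
set thw2 := expR (- (n%:R * (_ + delta))) in hN3.
set thy1 := expR (- (n%:R * (_ - delta))) in hN4.
set thy2 := expR (- (n%:R * (_ - delta))) in hN5.
pose z0 : {ffun 'I_n -> unit} := [ffun=> tt].
have ex (x : {ffun 'I_n -> X}) := tensor_power_eigen_dec (n := n) x e_l1.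
have ew1 (w : {ffun 'I_n -> W}) := tensor_power_eigen_dec (n := n) w e_m1.
have ew2 (w : {ffun 'I_n -> W}) := tensor_power_eigen_dec (n := n) w e_m2.
have ey1 := tensor_power_eigen_dec z0 (fun=> e_n1).
have ey2 := tensor_power_eigen_dec z0 (fun=> e_n2).
(* Codeword tests [P] and [P2] keep the large eigenvalues, which limits their rank; [G], [Q] and
   [Q2] keep the small ones, which caps the compressed states. *)
pose P (x : {ffun 'I_n -> X}) := spmx (tensor_power U1 x)
  (fun k : {ffun 'I_n -> B1} => (thx <= \prod_i l1 (x i) (k i))%R%:R).
pose G (w : {ffun 'I_n -> W}) := spmx (tensor_power V1 w)
  (fun k : {ffun 'I_n -> B1} => (\prod_i m1 (w i) (k i) <= thw1)%R%:R).
pose P2 (w : {ffun 'I_n -> W}) := spmx (tensor_power V2 w)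
  (fun k : {ffun 'I_n -> B2} => (thw2 <= \prod_i m2 (w i) (k i))%R%:R).
pose Q := spmx (tensor_power (fun=> Y1) z0)
  (fun k : {ffun 'I_n -> B1} => (\prod_i n1 (k i) <= thy1)%R%:R).
pose Q2 := spmx (tensor_power (fun=> Y2) z0)
  (fun k : {ffun 'I_n -> B2} => (\prod_i n2 (k i) <= thy2)%R%:R).
pose pw (w : {ffun 'I_n -> W}) : R := \prod_i pW (w i).
pose px (w : {ffun 'I_n -> W}) (x : {ffun 'I_n -> X}) : R := \prod_i pXW (w i) (x i).
have pw0 w : 0 <= pw w by exact: prodr_ge0.
have px0 w x : 0 <= px w x by exact: prodr_ge0.
have pw1 : \sum_w pw w = 1 by exact: (sum_ffun_prod1 (q := fun=> pW)).
have px1 w : \sum_x px w x = 1 by exact: (sum_ffun_prod1 (q := fun i => pXW (w i))).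
have sig1E w : \sum_x (px w x)%:C *: opmx (tensor_power r1 x) = opmx (tensor_power s1 w).
  exact: tensor_power_mix.
have sig2E w : \sum_x (px w x)%:C *: opmx (tensor_power r2 x) = opmx (tensor_power s2 w).
  exact: tensor_power_mix.
have tau1E : \sum_w (pw w)%:C *: (\sum_x (px w x)%:C *: opmx (tensor_power r1 x)) =
    opmx (tensor_power (fun=> t1) z0).
  by under eq_bigr do rewrite sig1E; exact: tensor_power_mix.
have tau2E : \sum_w (pw w)%:C *: (\sum_x (px w x)%:C *: opmx (tensor_power r2 x)) =
    opmx (tensor_power (fun=> t2) z0).
  by under eq_bigr do rewrite sig2E; exact: tensor_power_mix.
have prod0 (T : finType) (f : 'I_n -> T -> R) (k : {ffun 'I_n -> T}) :
  (forall i b, 0 <= f i b) -> 0 <= \prod_i f i (k i) by move=> f0; exact: prodr_ge0.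
have psd1 (x : {ffun 'I_n -> X}) : psdmx (opmx (tensor_power r1 x)).
  by apply: (eigen_dec_psd (ex x)) => k; exact: prodr_ge0.
have [U2 [l2 [e_l2 l20]]] := eigen_dec_family dens2.
have ex2 (x : {ffun 'I_n -> X}) := tensor_power_eigen_dec (n := n) x e_l2.
have psd2 (x : {ffun 'I_n -> X}) : psdmx (opmx (tensor_power r2 x)).
  by apply: (eigen_dec_psd (ex2 x)) => k; exact: prodr_ge0.
have tr1 (x : {ffun 'I_n -> X}) : rtr (opmx (tensor_power r1 x)) = 1.
  exact: tensor_power_rtr e_l1 l11.
have tr2 (x : {ffun 'I_n -> X}) : rtr (opmx (tensor_power r2 x)) = 1.
  apply: (tensor_power_rtr _ e_l2) => y.
  exact: eigen_dec_density_sum (dens2 y) (e_l2 y).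
(* The typicality bounds for the average states are those of a one-letter ensemble. *)
have single (f : {ffun 'I_n -> unit} -> R) : (forall z, 0 <= f z) ->
    f z0 <= \sum_z (\prod_(i < n) (1 : R)) * f z.
  move=> f0; rewrite (bigD1 z0) //= big1 ?mul1r // lerDl.
  by apply: sumr_ge0 => z _; rewrite mul1r.
apply: (@one_shot_code R _ _ I1 I2 _ _ pw px pw0 pw1 px0 px1
  (fun x => opmx (tensor_power r1 x)) (fun x => opmx (tensor_power r2 x))
  psd1 tr1 psd2 tr2 P G Q P2 Q2) => //.
- by move=> x; apply: projmx_spmx; exact: (ex x).1.
- by move=> w; apply: projmx_spmx; exact: (ew1 w).1.
- by apply: projmx_spmx; exact: ey1.1.
- by move=> w; apply: projmx_spmx; exact: (ew2 w).1.
- by apply: projmx_spmx; exact: ey2.1.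
- exact: expR_ge0.
- exact: expR_ge0.
- exact: expR_ge0.
(* [P x] depends on [x] alone, so summing out w^n turns the conditional weights into the i.i.d. law
   [pX], to which typicality was applied. *)
- apply: le_trans hN1; under eq_bigr do rewrite mulr_sumr.
  rewrite exchange_big /=; apply: ler_sum => x _.
  under eq_bigr do rewrite mulrA.
  rewrite -mulr_suml (sqn_spectral_compl (ex x)).
  rewrite -(sum_ffun_prod (fun i w => pW w * pXW w (x i))).
  by under [X in _ <= X * _]eq_bigr do rewrite big_split /=.
- apply: le_trans hN2; apply: ler_sum => w _.
  by rewrite sig1E (sqn_spectral_compl (ew1 w)).
- apply: le_trans hN4; rewrite tau1E.
  rewrite (sqn_spectral_compl ey1).
  apply: (single (fun z => \sum_(k : {ffun 'I_n -> B1} |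
    ~~ (\prod_i n1 (k i) <= thy1)) \prod_i n1 (k i))).
  by move=> z; apply: sumr_ge0 => k _; exact: prodr_ge0.
- apply: le_trans hN3; apply: ler_sum => w _.
  by rewrite sig2E (sqn_spectral_compl (ew2 w)).
- apply: le_trans hN5; rewrite tau2E.
  rewrite (sqn_spectral_compl ey2).
  apply: (single (fun z => \sum_(k : {ffun 'I_n -> B2} |
    ~~ (\prod_i n2 (k i) <= thy2)) \prod_i n2 (k i))).
  by move=> z; apply: sumr_ge0 => k _; exact: prodr_ge0.
- by move=> x; rewrite (rtr_spmx (ex x).1); exact: typical_card.
- move=> w; rewrite sig1E; apply: (spectral_compress_le (ew1 w)) => //.
  exact: expR_ge0.
- move=> w; rewrite sig1E; apply: (spectral_compress_le_self (ew1 w)) => k.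
  exact: prodr_ge0.
- rewrite tau1E.
  by apply: (spectral_compress_le ey1) => //; exact: expR_ge0.
- by move=> w; rewrite (rtr_spmx (ew2 w).1); exact: typical_card.
- rewrite tau2E.
  by apply: (spectral_compress_le ey2) => //; exact: expR_ge0.
Qed.

End IidCode.

(** * From matrices to codes for the broadcast channel *)

Section Wrapper.
Variable R : realType.
Local Notation C := (R[i])%type.

Lemma sum_pair (V : nmodType) (A B : finType) (F : A * B -> V) :
  \sum_p F p = \sum_a \sum_b F (a, b).
Proof. by rewrite pair_bigA; apply: eq_bigr => -[]. Qed.

Lemma psdmx_psd (T : finType) (A : op R T) : psdmx (opmx A) -> psd A.
Proof.
move=> hA v; have := hA (\row_j conjc (v (enum_val j))).
congr (0 <= _); rewrite mxE [RHS]exchange_big [RHS]sum_enum_val.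
apply: eq_bigr => j _; rewrite adjmxE !mxE conjcK mulr_suml [RHS]sum_enum_val.
by apply: eq_bigr => i _; rewrite !mxE.
Qed.

Definition mxop (T : finType) (M : 'M[C]_#|T|) : op R T :=
  fun s t => M (enum_rank s) (enum_rank t).

Lemma mxopK (T : finType) (M : 'M[C]_#|T|) : opmx (mxop M) = M.
Proof. by apply/matrixP => i j; rewrite mxE /mxop !enum_valK. Qed.

Lemma psd_mxop (T : finType) (M : 'M[C]_#|T|) : psdmx M -> psd (mxop M).
Proof. by move=> hM; apply: psdmx_psd; rewrite mxopK. Qed.

Lemma trmulE (T : finType) (P A : op R T) : trmul P A = \tr (opmx P *m opmx A).
Proof.
rewrite /trmul sum_enum_val; apply: eq_bigr => i _.
by rewrite mxE sum_enum_val; apply: eq_bigr => j _; rewrite !mxE.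
Qed.

Lemma psd_reindex (S T : finType) (h : S -> T) (A : op R T) : bijective h ->
  psd A -> psd (fun s t => A (h s) (h t)).
Proof.
move=> hb; have [g gK hK] := hb; move=> hA v; have := hA (fun t => v (g t)).
have bijP : {on [pred t | true], bijective h} by exact: onW_bij.
congr (0 <= _); rewrite (reindex h) //; apply: eq_bigr => s _.
by rewrite (reindex h) //; apply: eq_bigr => t _; rewrite !gK.
Qed.

(** Diagonalizing both factors expresses the trace as a nonnegative combination of values of the
    quadratic form of [rho] at product vectors. *)
Lemma trmul_tens_ge0 (A B : finType) (P : op R A) (Q : op R B) (rho : op R (A * B)%type) :
  psd P -> psd Q -> psd rho -> 0 <= trmul (tens P Q) rho.
Proof.
move=> /psd_eigen_dec[U [d [[_ hP] d0]]] /psd_eigen_dec[V [e [[_ hQ] e0]]] hrho.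
have -> : trmul (tens P Q) rho = \sum_k \sum_l (d k * e l)%:C *
   \sum_t \sum_s conjc (U t.1 k * V t.2 l) * rho t s * (U s.1 k * V s.2 l).
  transitivity (\sum_s \sum_t \sum_k \sum_l (d k * e l)%:C *
     (conjc (U t.1 k * V t.2 l) * rho t s * (U s.1 k * V s.2 l))).
    apply: eq_bigr => s _; apply: eq_bigr => t _; rewrite /tens hP hQ.
    rewrite -mulrA mulr_suml; apply: eq_bigr => k _.
    rewrite mulr_suml mulr_sumr; apply: eq_bigr => l _.
    by rewrite !rmorphM /=; ring.
  under eq_bigr do rewrite exchange_big.
  rewrite exchange_big; apply: eq_bigr => k _.
  under eq_bigr do rewrite exchange_big.
  rewrite exchange_big; apply: eq_bigr => l _.
  rewrite exchange_big mulr_sumr; apply: eq_bigr => t _.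
  by rewrite mulr_sumr.
apply: sumr_ge0 => k _; apply: sumr_ge0 => l _.
rewrite mulr_ge0 ?ler0c ?mulr_ge0 //; exact: hrho.
Qed.

Lemma trmul_tens_idr (A B : finType) (P : op R A) (rho : op R (A * B)%type) :
  trmul (tens P (idop R (T := B))) rho = trmul P (marg fst snd rho).
Proof.
rewrite /trmul sum_pair.
apply: eq_bigr => a _.
transitivity (\sum_b \sum_a' P a a' * rho (a', b) (a, b)).
  apply: eq_bigr => b _.
  rewrite sum_pair; apply: eq_bigr => a' _.
  rewrite /tens /idop (bigD1 b) //= eqxx mulr1 big1 ?addr0 // => b' bb.
  by rewrite eq_sym (negPf bb) mulr0 mul0r.
rewrite exchange_big; apply: eq_bigr => a' _.
by rewrite (margE (mk := pair)) ?mulr_sumr // => -[].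
Qed.

Lemma trmul_tens_idl (A B : finType) (Q : op R B) (rho : op R (A * B)%type) :
  trmul (tens (idop R (T := A)) Q) rho = trmul Q (marg snd fst rho).
Proof.
rewrite /trmul sum_pair.
rewrite exchange_big; apply: eq_bigr => b _.
transitivity (\sum_a \sum_b' Q b b' * rho (a, b') (a, b)).
  apply: eq_bigr => a _.
  rewrite sum_pair (bigD1 a) //= [X in _ + X]big1 ?addr0.
    by apply: eq_bigr => b' _; rewrite /tens /idop eqxx mul1r.
  move=> a' aa; apply: big1 => b' _.
  by rewrite /tens /idop eq_sym (negPf aa) !mul0r.
rewrite exchange_big; apply: eq_bigr => b' _.
by rewrite (margE (mk := fun u v => (v, u))) ?mulr_sumr // => -[].
Qed.

Lemma complex_of_ge0 (x : C) : 0 <= x -> x = (re x)%:C.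
Proof. by move=> x0; rewrite [LHS]complexE (ger0_Im x0) mulr0 addr0. Qed.

Lemma opB_rtr (T : finType) (P A : op R T) : density A ->
  re (trmul (fun s t => idop R s t - P s t) A) = 1 - rtr (opmx P *m opmx A).
Proof.
move=> [_ tA]; rewrite trmulE -/(rtr _).
have -> : opmx (fun s t => idop R s t - P s t) = 1%:M - opmx P.
  by apply/matrixP => i j; rewrite !mxE /idop (inj_eq enum_val_inj).
rewrite mulmxBl mul1mx rtrB; congr (_ - _).
have -> : rtr (opmx A) = re (trace A).
  by rewrite /trace sum_enum_val /rtr; congr re; apply: eq_bigr => i _; rewrite mxE.
by rewrite tA.
Qed.

(* (1 - P) (x) (1 - Q) is positive, hence 1 - P (x) Q <= (1 - P) (x) 1 + 1 (x) (1 - Q). *)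
Lemma joint_error_le (A B : finType) (P : op R A) (Q : op R B) (rho : op R (A * B)%type) :
  density rho -> psd (fun s t => idop R s t - P s t) ->
  psd (fun s t => idop R s t - Q s t) ->
  psd P -> psd Q ->
  trmul (fun s t => idop R s t - tens P Q s t) rho <=
  ((1 - rtr (opmx P *m opmx (marg fst snd rho)))
   + (1 - rtr (opmx Q *m opmx (marg snd fst rho))))%:C.
Proof.
move=> hrho cP cQ hP hQ.
have d1 : density (marg fst snd rho) by apply: (marg_density (mk := pair)) => // -[].
have d2 : density (marg snd fst rho).
  by apply: (marg_density (mk := fun u v => (v, u))) => // -[].
have id_psd (T : finType) : psd (idop R (T := T)).
  apply: psdmx_psd; have -> : opmx (idop R (T := T)) = 1%:M.
    by apply/matrixP => i j; rewrite !mxE /idop (inj_eq enum_val_inj).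
  exact: psdmx1.
set P' := fun s t => _ - _ in cP; set Q' := fun s t => _ - _ in cQ.
have g1 := trmul_tens_ge0 cP (id_psd B) hrho.1.
have g2 := trmul_tens_ge0 (id_psd A) cQ hrho.1.
have g3 := trmul_tens_ge0 cP cQ hrho.1.
rewrite rmorphD /= -(opB_rtr P d1) -(opB_rtr Q d2) -/P' -/Q'.
rewrite -trmul_tens_idr -trmul_tens_idl -!complex_of_ge0 //.
rewrite -subr_ge0; move: g3; congr (0 <= _).
rewrite /trmul -big_split -sumrB; apply: eq_bigr => s _.
rewrite -big_split -sumrB; apply: eq_bigr => t _ /=.
rewrite /tens /P' /Q'.
have -> : idop R s t = idop R s.1 t.1 * idop R s.2 t.2.
  by rewrite /idop -natrM mulnb -xpair_eqE -!surjective_pairing.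
by ring.
Qed.

(** [nstate] is indexed by pairs of sequences, the tensor power by sequences of pairs; the bijection
    [h] transports positivity and trace. *)
Lemma nstate_density (X B1 B2 : finType) (rho : X -> op R (B1 * B2)%type) (n : nat)
  (x : 'I_n -> X) : (forall x, density (rho x)) -> density (nstate rho x).
Proof.
move=> hrho.
have [U [d [hd d0]]] := eigen_dec_family hrho.
have psdt : psd (tensor_power rho x).
  apply: psdmx_psd; apply: (eigen_dec_psd (tensor_power_eigen_dec x hd)).
  by move=> k; apply: prodr_ge0.
pose h (s : {ffun 'I_n -> B1} * {ffun 'I_n -> B2}) : {ffun 'I_n -> B1 * B2} :=
  [ffun i => (s.1 i, s.2 i)].
have hb : bijective h.
  exists (fun u : {ffun 'I_n -> B1 * B2} => ([ffun i => (u i).1], [ffun i => (u i).2])).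
    by case=> s1 s2; congr pair; apply/ffunP => i; rewrite !ffunE.
  by move=> u; apply/ffunP => i; rewrite !ffunE -surjective_pairing.
have E s t : nstate rho x s t = tensor_power rho x (h s) (h t).
  by apply: eq_bigr => i _; rewrite !ffunE.
split.
  have -> : nstate rho x = fun s t => tensor_power rho x (h s) (h t).
    by apply/funext => s; apply/funext => t; exact: E.
  exact: psd_reindex.
rewrite /trace; under eq_bigr do rewrite E.
rewrite -(reindex h (P := predT) (F := fun u => tensor_power rho x u u)) /=;
  last exact: onW_bij.
rewrite /tensor_power -(bigA_distr_bigA (fun i b => rho (x i) b b)) big1 // => i _.
exact: (hrho _).2.
Qed.

Lemma nstate_rcv1 (X B1 B2 : finType) (rho : X -> op R (B1 * B2)%type) (n : nat)
  (x : 'I_n -> X) : marg fst snd (nstate rho x) = tensor_power (rcv1 rho) x.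
Proof.
apply/funext => s; apply/funext => t; rewrite (margE (mk := pair)) //; [|by case].
rewrite /nstate /tensor_power /=.
rewrite -(bigA_distr_bigA (fun i b => rho (x i) (s i, b) (t i, b))).
by apply: eq_bigr => i _; rewrite rcv1E.
Qed.

Lemma nstate_rcv2 (X B1 B2 : finType) (rho : X -> op R (B1 * B2)%type) (n : nat)
  (x : 'I_n -> X) : marg snd fst (nstate rho x) = tensor_power (rcv2 rho) x.
Proof.
apply/funext => s; apply/funext => t.
rewrite (margE (mk := fun u v => (v, u))) //; [|by case].
rewrite /nstate /tensor_power /=.
rewrite -(bigA_distr_bigA (fun i b => rho (x i) (b, s i) (b, t i))).
by apply: eq_bigr => i _; rewrite rcv2E.
Qed.

Lemma povm_mxop (I T : finType) (L : I -> 'M[C]_#|T|) :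
  (forall i, psdmx (L i)) -> \sum_i L i = 1%:M ->
  povm (fun i => mxop (L i)).
Proof.
move=> psdL sumL; split=> [i|s t]; first exact: psd_mxop.
by rewrite /mxop -summxE sumL mxE (inj_eq enum_rank_inj).
Qed.

Lemma psd_mxop_compl (I T : finType) (L : I -> 'M[C]_#|T|) (i : I) :
  (forall i, psdmx (L i)) -> \sum_i L i = 1%:M ->
  psd (fun s t => idop R s t - mxop (L i) s t).
Proof.
move=> psdL sumL; apply: psdmx_psd.
have -> : opmx (fun s t => idop R s t - mxop (L i) s t) = \sum_(j | j != i) L j.
  have -> : \sum_(j | j != i) L j = 1%:M - L i.
    apply: (@addrI _ (L i)); rewrite [RHS]addrC subrK -sumL [RHS](bigD1 i) //.
  by apply/matrixP => k l; rewrite !mxE /idop /mxop !enum_valK (inj_eq enum_val_inj).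
by apply: (big_ind (@psdmx R _)) => // [|A B]; [exact: psdmx0 | exact: psdmxD].
Qed.

End Wrapper.

(** * Rates *)

Section CodeSize.
Variable R : realType.

Lemma pow2E (x : R) : 2 `^ x = expR (x * ln 2).
Proof. by rewrite /powR gt_eqF. Qed.

Lemma msize_ceil (n : nat) (r : R) :
  (msize n r)%:Z = Num.ceil (2 `^ (n%:R * r)) /\ (0 < msize n r)%N.
Proof.
have h : 0 < Num.ceil (2 `^ (n%:R * r) : R) by rewrite ceil_gt0 powR_gt0.
split; first by rewrite /msize gez0_abs // ltW.
by rewrite /msize absz_gt0 gt_eqF.
Qed.

Lemma msize_gt0 (n : nat) (r : R) : (0 < msize n r)%N.
Proof. by have [] := msize_ceil n r. Qed.

(** Only wrong messages are counted, and subtracting the correct one absorbs the rounding of the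
    ceiling. The bound also holds for negative rates. *)
Lemma msize_pred_le (n : nat) (r : R) :
  ((msize n r).-1)%:R <= expR (n%:R * (r * ln 2)).
Proof.
have [h1 h2] := msize_ceil n r; rewrite mulrA -pow2E.
have := ceilB1_lt (2 `^ (n%:R * r) : R); rewrite -h1 => /ltW.
by rewrite -(prednK h2) /= -addn1 PoszD addrK.
Qed.

(** For Receiver 2 the personal rate 0 - delta is negative, so its personal message set is a single
    point. *)
Lemma msize_neg (n : nat) (r : R) : r <= 0 -> msize n r = 1%N.
Proof.
move=> r0; have [h1 h2] := msize_ceil n r.
apply/eqP; rewrite eqn_leq h2 andbT -lez_nat h1 ceil_le_int pow2E.
rewrite -[1%:~R]expR0 ler_expR mulr_le0_ge0 ?ln_ge0 ?ler1n //.
by rewrite mulr_ge0_le0.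
Qed.

Lemma mul_expR_le (a s u v w : R) :
  0 <= a -> a <= expR s -> s + u + v <= w -> a * (expR u * expR v) <= expR w.
Proof.
move=> a0 ha h; apply: (@le_trans _ _ (expR s * (expR u * expR v))).
  by rewrite ler_wpM2r // mulr_ge0 ?expR_ge0.
by rewrite -!expRD ler_expR addrA.
Qed.

(** Running at rates reduced by [delta] leaves a slack of at least delta ln 2 in each exponent, and
    two typicality margins [d] consume half of it. The factor [msize] is one more than its
    predecessor, so the cross-cloud term splits in two; the part without k1 uses R1 >= 0. Four
    exponentials remain. *)
Lemma code_size_bounds (n : nat) (R1 Rc delta d Hx Hw1 Hy1 Hy2 Hw2 : R) :
  d = delta * ln 2 / 4 ->
  0 <= R1 -> 0 <= Rc -> 0 < delta ->
  R1 * ln 2 <= Hw1 - Hx -> Rc * ln 2 <= Hy2 - Hw2 ->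
  (R1 + Rc) * ln 2 <= Hy1 - Hx ->
  (msize n (R1 - delta)).-1%:R * (expR (- (n%:R * (Hw1 - d))) * expR (n%:R * (Hx + d)))
  + (msize n (Rc - delta)).-1%:R * ((msize n (R1 - delta))%:R *
      (expR (- (n%:R * (Hy1 - d))) * expR (n%:R * (Hx + d))))
  + (msize n (Rc - delta)).-1%:R * (expR (- (n%:R * (Hy2 - d))) * expR (n%:R * (Hw2 + d)))
  <= 4 * expR (- (delta * ln 2 / 2)) ^+ n.
Proof.
move=> hd hR1 hRc dl h1 h2 h3.
have l0 : 0 < ln 2 :> R by rewrite ln_gt0 // ltr1n.
have b1 := msize_pred_le n (R1 - delta); have b2 := msize_pred_le n (Rc - delta).
set k1 := (msize n (R1 - delta)).-1%:R in b1 *.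
set k2 := (msize n (Rc - delta)).-1%:R in b2 *.
have -> : (msize n (R1 - delta))%:R = 1 + k1 
  by rewrite [RHS]addrC /k1 natr1 prednK ?msize_gt0.
have k10 : 0 <= k1 by exact: ler0n.
have k20 : 0 <= k2 by exact: ler0n.
rewrite -expRM_natl; set w := n%:R * - (delta * ln 2 / 2).
have n0 : 0 <= n%:R :> R by exact: ler0n.
have R1l : 0 <= R1 * ln 2 by rewrite mulr_ge0 // ltW.
have dl0 : 0 < delta * ln 2 by rewrite mulr_gt0.
have c1 : k1 * (expR (- (n%:R * (Hw1 - d))) * expR (n%:R * (Hx + d))) <= expR w.
  apply: (mul_expR_le k10 b1); rewrite /w -mulrN -!mulrDr ler_wpM2l //.
  by move: h1 dl0; rewrite hd; lra.
have c3 : k2 * (expR (- (n%:R * (Hy2 - d))) * expR (n%:R * (Hw2 + d))) <= expR w.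
  apply: (mul_expR_le k20 b2); rewrite /w -mulrN -!mulrDr ler_wpM2l //.
  by move: h2 dl0; rewrite hd; lra.
have c2 : k2 * (expR (- (n%:R * (Hy1 - d))) * expR (n%:R * (Hx + d))) <= expR w.
  apply: (mul_expR_le k20 b2); rewrite /w -mulrN -!mulrDr ler_wpM2l //.
  by move: h3 R1l dl0; rewrite hd; lra.
have b12 : k2 * k1 <= expR (n%:R * ((Rc - delta) * ln 2) + n%:R * ((R1 - delta) * ln 2)).
  by rewrite expRD; apply: ler_pM.
have c2' : (k2 * k1) * (expR (- (n%:R * (Hy1 - d))) * expR (n%:R * (Hx + d))) <= expR w.
  apply: (mul_expR_le (mulr_ge0 k20 k10) b12).
  rewrite /w -mulrN -!mulrDr ler_wpM2l //.
  by move: h3 dl0; rewrite hd; lra.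
move: c1 c2 c2' c3; set x1 := expR _ * expR _; set x2 := expR _ * expR _.
set x3 := expR _ * expR _; move: (expR w) => y; clear; lra.
Qed.

End CodeSize.

(** * Choice of parameters and the coding theorem *)

Lemma mean_shannon_nats (R : realType) (Z T : finType) (p : Z -> R) (q : Z -> T -> R) :
  \sum_z p z * shannon_nats (q z) = ln 2 * \sum_z p z * shannon (q z).
Proof.
by rewrite mulr_sumr; apply: eq_bigr => z _; rewrite shannon_natsE mulrCA.
Qed.

Theorem theorem6p1 (R : realType) (X B1 B2 W : finType)
  (rho : X -> op R (B1 * B2)%type) (hrho : forall x, density (rho x))
  (pW : W -> R) (pXW : W -> X -> R)
  (hpW0 : forall w, 0 <= pW w) (hpW1 : \sum_w pW w = 1)
  (hpXW0 : forall w x, 0 <= pXW w x) (hpXW1 : forall w, \sum_x pXW w x = 1)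
  (R1 Rc : R) (hR1 : 0 <= R1) (hRc : 0 <= Rc)
  (h1 : R1 <= qCMI (marg (fun t : W * X * B1 * B2 => (t.1.1.2, t.1.2, t.1.1.1))
                         (fun t => t.2) (theta pW pXW rho)))
  (h2 : Rc <= qMI (marg (fun t : W * X * B1 * B2 => (t.1.1.1, t.2))
                        (fun t => (t.1.1.2, t.1.2)) (theta pW pXW rho)))
  (h3 : R1 + Rc <= qMI (marg (fun t : W * X * B1 * B2 => (t.1.1.2, t.1.2))
                             (fun t => (t.1.1.1, t.2)) (theta pW pXW rho))) :
  achievable rho R1 Rc 0.
Proof.
have dens1 x : density (rcv1 rho x) by exact: rcv1_density.
have dens2 x : density (rcv2 rho x) by exact: rcv2_density.
have s1_density w : density (mix (pXW w) (rcv1 rho)) by exact: mix_density.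
have s2_density w : density (mix (pXW w) (rcv2 rho)) by exact: mix_density.
have [U1 [l1 [e_l1 l10]]] := eigen_dec_family dens1.
have [V1 [m1 [e_m1 m10]]] := eigen_dec_family s1_density.
have [V2 [m2 [e_m2 m20]]] := eigen_dec_family s2_density.
have [Y1 [n1 [e_n1 n10]]] := psd_eigen_dec (mix_density hpW0 hpW1 s1_density).1.
have [Y2 [n2 [e_n2 n20]]] := psd_eigen_dec (mix_density hpW0 hpW1 s2_density).1.
rewrite (cond_info_receiver1 hrho hpW0 hpXW0 hpXW1 e_l1 l10 e_m1 m10) in h1.
rewrite (info_receiver2 hrho hpW0 hpXW0 hpXW1 e_m2 m20 e_n2) in h2.
rewrite (info_receiver1 hrho hpW0 hpXW0 e_l1 l10 e_n1) in h3.
have l0 : 0 < ln 2 :> R by rewrite ln_gt0 // ltr1n.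
have hxE : \sum_w pW w * \sum_x pXW w x * shannon_nats (l1 x) =
    ln 2 * \sum_w pW w * \sum_x pXW w x * shannon (l1 x).
  by rewrite mulr_sumr; apply: eq_bigr => w _; rewrite mean_shannon_nats mulrCA.
have {}h1 : R1 * ln 2 <= \sum_w pW w * shannon_nats (m1 w)
    - \sum_w pW w * \sum_x pXW w x * shannon_nats (l1 x).
  by rewrite mean_shannon_nats hxE -mulrBr mulrC ler_pM2l.
have {}h2 : Rc * ln 2 <= shannon_nats n2 - \sum_w pW w * shannon_nats (m2 w).
  by rewrite mean_shannon_nats shannon_natsE -mulrBr mulrC ler_pM2l.
have {}h3 : (R1 + Rc) * ln 2 <= shannon_nats n1
    - \sum_w pW w * \sum_x pXW w x * shannon_nats (l1 x).
  by rewrite shannon_natsE hxE -mulrBr mulrC ler_pM2l.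
move=> eps delta eps0 delta0.
have dl0 : 0 < delta * ln 2 / 4 by rewrite divr_gt0 ?mulr_gt0.
(* With t = eps/4, the term 2t is eps/2, and the typicality and code-size terms 130 e + 16 e divided
   by t give 584/2000 eps, below the remaining eps/2. *)
have e0 : 0 < eps ^+ 2 / 2000 by rewrite divr_gt0 ?exprn_gt0.
have [N1 hN1] := iid_code hpW0 hpW1 hpXW0 hpXW1 dens1 dens2 e_l1 l10 e_m1 m10
  e_m2 m20 e_n1 n10 e_n2 n20 dl0 e0.
have c01 : 0 <= expR (- (delta * ln 2 / 2)) < 1.
  by rewrite expR_ge0 expR_lt1 oppr_lt0 divr_gt0 ?mulr_gt0.
have [N2 hN2] := expr_eventually_le c01 e0.
exists (maxn N1 N2) => n; rewrite geq_max => /andP[/hN1 {}hN1 /hN2 {}hN2].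
pose i1 := Ordinal (msize_gt0 n (R1 - delta)).
pose i2 := Ordinal (msize_gt0 n (Rc - delta)).
have t0 : 0 < eps / 4 by rewrite divr_gt0.
have [g [L1 [L2 [[psdL1 sumL1] [psdL2 sumL2] herr]]]] := hN1 _ _ i1 i2 _ t0.
have M3 : msize n (0 - delta) = 1%N by rewrite msize_neg // sub0r oppr_le0 ltW.
(* The codebook ignores the third message, which takes a single value, and the measurement of
   Receiver 2 reads only the common one. *)
exists (fun a b _ i => g a b i), (fun p => mxop (L1 p)), (fun p => mxop (L2 p.1)).
split; first exact: povm_mxop.
  split=> [p|s t]; first exact: psd_mxop.
  rewrite sum_pair -(povm_mxop psdL2 sumL2).2; apply: eq_bigr => b _ /=.
  by rewrite sumr_const card_ord M3.
rewrite !card_ord in herr.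
have hsize := code_size_bounds n erefl hR1 hRc delta0 h1 h2 h3.
pose err a b : R := (1 - rtr (L1 (a, b) *m opmx (tensor_power (rcv1 rho) (g a b))))
  + (1 - rtr (L2 b *m opmx (tensor_power (rcv2 rho) (g a b)))).
have {}herr : \sum_a \sum_b err a b <=
    ((msize n (R1 - delta) * msize n (Rc - delta)) %:R) * eps.
  rewrite exchange_big; apply: le_trans herr _.
  rewrite -natrM mulnC ler_wpM2l //.
  apply: (@le_trans _ _ (2 * (eps / 4) + (eps / 4)^-1 * (146 * (eps ^+ 2 / 2000)))).
    rewrite lerD2l ler_pM2l ?invr_gt0 //.
    apply: (@le_trans _ _ (130 * (eps ^+ 2 / 2000) + 4 * (4 * (eps ^+ 2 / 2000)))).
      by rewrite lerD2l ler_pM2l //; apply: le_trans hsize _; rewrite ler_pM2l.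
    by lra.
  have -> : (eps / 4)^-1 * (146 * (eps ^+ 2 / 2000)) = eps * (584 / 2000).
    by field; rewrite gt_eqF.
  by lra.
have M0 : 0 < (msize n (R1 - delta) * msize n (Rc - delta) * msize n (0 - delta))%:R :> R[i].
  by rewrite ltr0n !muln_gt0 !msize_gt0.
rewrite ler_pdivrMl //.
apply: (@le_trans _ _ (\sum_a \sum_b err a b)%:C).
  rewrite rmorph_sum /=; apply: ler_sum => a _; rewrite rmorph_sum /=.
  apply: ler_sum => b _.
  apply: (@le_trans _ _ (\sum_(c < msize n (0 - delta)) (err a b)%:C)).
    apply: ler_sum => c _.
    have := joint_error_le (nstate_density (g a b) hrho)
      (psd_mxop_compl (a, b) psdL1 sumL1) (psd_mxop_compl b psdL2 sumL2)
      (psd_mxop (psdL1 (a, b))) (psd_mxop (psdL2 b)).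
    by rewrite !mxopK nstate_rcv1 nstate_rcv2.
  by rewrite sumr_const card_ord M3.
rewrite M3 muln1 -(rmorph_nat (real_complex R)) -rmorphM /= lecR.
exact: herr.
Qed.
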